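(* (i) For every $\delta > 0$ there exists $d_0 = d_0(\delta)$ such that for every integer $d \geq d_0$, every $d$-regular graph $G$ satisfies \[ \chi_c(G) \geq (1 - \delta)\frac{d}{\log d}. \] (ii) For every $\epsilon > 0$ there exists $d_1(\epsilon)$ such that for every integer $d \geq d_1(\epsilon)$, the probability that a graph $G$ chosen uniformly at random from the set of all $d$-regular graphs on vertex set $\{1,\dots,n\}$ satisfies \[ \chi_c(G) \leq (1 + \epsilon)\frac{d}{\log d} \] tends to $1$ as $n \to \infty$ (over $n$ with $nd$ even).
   Context: Let $G$ be a finite graph with no isolated vertices. For a positive integer $k$, a $k$-coupon coloring of $G$ is an assignment of colors from $[k] = \{1,\dots,k\}$ to the vertices of $G$ such that for every vertex $v$, the neighborhood $\Gamma(v)$ of $v$ contains vertices of every color in $[k]$. The coupon coloring number $\chi_c(G)$ is the maximum $k$ for which a $k$-coupon coloring of $G$ exists. Here $\log$ denotes the natural logarithm. *)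

(* Defs.v *)
From HB Require Import structures.
From mathcomp Require Import all_boot all_order all_algebra.
From mathcomp Require Import all_classical all_reals all_analysis.

Set Implicit Arguments.
Unset Strict Implicit.
Unset Printing Implicit Defensive.

Import Order.TTheory GRing.Theory Num.Theory.
Import numFieldNormedType.Exports.

Local Open Scope ring_scope.

(* Simple graphs with vertex set T, given by their edge sets; on a fixed T they
   form a finite type. *)
Record sgraph (T : finType) := SGraph {
  edges : {set {set T}};
  _ : [forall e in edges, #|e| == 2]
}.

HB.instance Definition _ (T : finType) := [isSub for @edges T].
HB.instance Definition _ (T : finType) := [Finite of sgraph T by <:].

Definition nbhd (T : finType) (G : sgraph T) (v : T) : {set T} :=
  [set u | [set v; u] \in edges G].

Definition regular (T : finType) (d : nat) (G : sgraph T) : bool :=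
  [forall v, #|nbhd G v| == d].

Definition coupon_coloring (T : finType) (G : sgraph T) (k : nat)
    (c : {ffun T -> 'I_k}) : bool :=
  [forall v, forall i : 'I_k, exists u in nbhd G v, c u == i].

Definition coupon_colorable (T : finType) (G : sgraph T) (k : nat) : bool :=
  [exists c : {ffun T -> 'I_k}, coupon_coloring G c].

(* The bound k <= #|T| loses nothing when T is nonempty, and the maximum is
   attained when moreover no vertex is isolated: see couponnumP. *)
Definition couponnum (T : finType) (G : sgraph T) : nat :=
  \max_(k < #|T|.+1 | coupon_colorable G k) k.

Lemma nbhd_irr (T : finType) (G : sgraph T) (v : T) : v \notin nbhd G v.
Proof.
case: G => E hE; rewrite inE /=; apply/negP => vE.
by have := forallP hE [set v; v]; rewrite vE /= finset.setUid cards1.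
Qed.

Lemma coupon_colorable_leq (T : finType) (G : sgraph T) (k : nat) (v : T) :
  coupon_colorable G k -> (k <= #|nbhd G v|)%N.
Proof.
move=> /existsP[c /forallP/(_ v)/forallP hc].
rewrite -[k]card_ord -cardsT.
suff /subset_leq_card h : [set: 'I_k] \subset c @: nbhd G v.
  exact: leq_trans h (leq_imset_card _ _).
apply/fintype.subsetP => i _; have /existsP[u /andP[uv /eqP <-]] := hc i.
exact: imset_f.
Qed.

Lemma couponnumP (T : finType) (G : sgraph T) :
  (0 < #|T|)%N -> (forall v, nbhd G v != finset.set0) ->
  [/\ (0 < couponnum G)%N, coupon_colorable G (couponnum G)
    & forall k, coupon_colorable G k -> (k <= couponnum G)%N].
Proof.
move=> T0 iso.
have ub k : coupon_colorable G k -> (k <= couponnum G)%N.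
  move=> hk; have /card_gt0P[v _] := T0.
  have kT : (k < #|T|.+1)%N.
    by rewrite ltnS (leq_trans (coupon_colorable_leq v hk)) ?max_card.
  exact: (leq_bigmax_cond (Ordinal kT) hk).
have h1 : coupon_colorable G 1.
  apply/existsP; exists [ffun=> ord0]; apply/forallP => v; apply/forallP => i.
  have /finset.set0Pn[u uv] := iso v.
  by apply/existsP; exists u; rewrite uv /= [i]ord1 [c in c == _]ord1.
split=> //; first exact: ub.
have T1 : (1 < #|T|.+1)%N by rewrite ltnS.
rewrite /couponnum (bigop.bigmax_eq_arg (Ordinal T1)) //.
by case: arg_maxnP.
Qed.

(* Probability of E under the uniform distribution on A; it is 0 if A is
   empty. *)
Definition unif_prob (R : realType) (X : finType) (A E : {set X}) : R :=
  #|A :&: E|%:R / #|A|%:R.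

(* Main.v *)
(** Lower bound. Colour the vertices uniformly with K = k + r colours, where
    k ~ (1 - delta) d / log d and K <= (1 - delta/2) d / log d. For a vertex u let
    L(u) be the set of colours missing from the neighbourhood of some neighbour of
    u. A given colour lies in L(u) with probability at most
    d (1 - 1/K)^d <= d^(-delta/2), and these events behave like independent ones,
    so the local lemma makes every L(u) of size at most m = O(d^(1 - delta/2)). As
    each vertex misses at most m colours, it sees at least r - m of the r spare
    colours. Recolour each spare vertex u by a random element of L(u); a colour
    missing at v stays missing with probability at most (1 - 1/m)^(r - m), which is
    superpolynomially small in d, and the local lemma applies again.

    Upper bound. The smallest of k colour classes is a set S of at most n/k
    vertices such that every vertex has a neighbour in S. Fix S and let g(t) be the
    number of d-regular graphs with exactly t undominated vertices outside S. For a
    dominated v outside S, edge switchings vu, ab -> va, ub with u in S and a, b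
    outside S remove the edges from v to S one at a time. Double counting them gives
    (n - |S| - t) g(t) <= (t + 1) (1 + |S|/M)^d g(t + 1) with M = (1 - o(1)) n,
    where (1 + |S|/M)^d <= d^beta for some beta < 1. Hence
    g(0) <= 2^(-N) sum_t g(t) with N ~ n d^(-beta) / 4, which beats the
    exp(O(n log^2 d / d)) choices of S. *)
Require Import Defs.
From mathcomp Require Import all_boot all_order all_algebra.
From mathcomp Require Import zify ring lra.

Set Implicit Arguments.
Unset Strict Implicit.
Unset Printing Implicit Defensive.

Import Order.TTheory GRing.Theory Num.Theory.

Local Open Scope ring_scope.

(** * The local lemma *)

(** Exchanging the coordinates outside [X] is an involution on pairs of functions; under it the
    preimage of the product of [B] and [C] is [B :&: C] times the whole space. *)
Lemma card_indep_events (T A : finType) (X : {set T})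
    (B C : {set {ffun T -> A}}) :
  (forall f g : {ffun T -> A}, {in X, f =1 g} -> (f \in B) = (g \in B)) ->
  (forall f g : {ffun T -> A}, {in ~: X, f =1 g} -> (f \in C) = (g \in C)) ->
  (#|B :&: C| * #|{ffun T -> A}| = #|B| * #|C|)%N.
Proof.
move=> hB hC.
pose mix (f g : {ffun T -> A}) := [ffun x => if x \in X then f x else g x].
pose swap (p : {ffun T -> A} * {ffun T -> A}) := (mix p.1 p.2, mix p.2 p.1).
have swapK : involutive swap.
  move=> [f g]; congr (_, _) => /=; apply/ffunP => x; rewrite !ffunE /=;
  by case: (x \in X).
rewrite -[#|{ffun T -> A}|]cardsT -!cardsX -[RHS](@on_card_preimset _ _ swap).
  apply: eq_card => -[f g]; rewrite !inE /= andbT.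
  rewrite (hB (mix f g) f) ?(hC (mix g f) f) //.
    by move=> x; rewrite inE ffunE => /negbTE->.
  by move=> x; rewrite ffunE => ->.
by apply: onW_bij; exact: inv_bij.
Qed.

Definition avoid (T A : finType) (B : T -> {set {ffun T -> A}}) (X : {set T}) :=
  [set f | [forall v in X, f \notin B v]].

(* The conditional probability of B v, given that the events indexed by X are
   avoided, is at most 2p. *)
Lemma local_lemma_aux (F : realFieldType) (T A : finType)
    (B : T -> {set {ffun T -> A}}) (S : T -> {set T}) (D : nat) (p : F) :
  (0 < #|A|)%N ->
  (forall v (f g : {ffun T -> A}),
     {in S v, f =1 g} -> (f \in B v) = (g \in B v)) ->
  (forall v, #|[set w | ~~ [disjoint S v & S w]]| <= D)%N ->
  (forall v, #|B v|%:R <= p * #|{ffun T -> A}|%:R) ->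
  0 <= p -> 4 * p * D%:R <= 1 ->
  forall (X : {set T}) v,
    #|B v :&: avoid B X|%:R <= 2 * p * #|avoid B X|%:R.
Proof.
move=> A0 hS hD hp p0 hpD X.
have [n] := ubnP #|X|; elim: n X => // n IH X leXn v.
(* [X2] indexes the events independent of [B v]; at most [D] others remain in [X1]. *)
pose X2 := X :&: [set w | [disjoint S v & S w]].
pose X1 := X :\: X2.
have X1D : (#|X1| <= D)%N.
  apply: leq_trans (hD v); apply/subset_leq_card/subsetP => w.
  by rewrite !inE; case: (w \in X); rewrite ?andbF //= andbT.
have h1 : #|B v :&: avoid B X|%:R <= p * #|avoid B X2|%:R :> F.
  apply: (@le_trans _ _ #|B v :&: avoid B X2|%:R).
    rewrite ler_nat; apply/subset_leq_card/setIS/subsetP => f.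
    rewrite !inE => /forall_inP h; apply/forall_inP => w.
    by rewrite inE => /andP[/h].
  have Om : 0 < #|{ffun T -> A}|%:R :> F.
    by rewrite ltr0n card_ffun expn_gt0 A0.
  rewrite -(ler_pM2r Om) -natrM (@card_indep_events _ _ (S v)).
  - by rewrite natrM mulrAC ler_wpM2r.
  - exact: hS.
  - move=> f g fg; rewrite !inE; apply: eq_forallb => w.
    case: (boolP (w \in X2)) => //=; rewrite !inE => /andP[_ dw].
    congr (~~ _); apply: hS => x xw; apply: fg; rewrite inE.
    by apply: contraL xw => xv; rewrite (disjointFr dw xv).
(* By induction and a union bound, the events of [X1] remove at most a fraction 2pD <= 1/2 of
   [avoid B X2]. *)
have h2 : #|avoid B X2|%:R <= 2 * #|avoid B X|%:R :> F.
  have [X10|X1n] := boolP (X1 == set0).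
    have -> : X2 = X.
      by apply/eqP; rewrite eqEsubset subsetIl -setD_eq0.
    by rewrite ler_peMl // ler1n.
  have lt2 : (#|X2| < n)%N.
    rewrite -ltnS; apply: leq_trans leXn; rewrite ltnS; apply: proper_card.
    rewrite properEneq subsetIl andbT; apply: contraNneq X1n => e.
    by rewrite /X1 e setDv.
  have cov : avoid B X2 \subset
      avoid B X :|: \bigcup_(w in X1) (B w :&: avoid B X2).
    apply/subsetP => f fX2; rewrite inE.
    have [//|/=] := boolP (f \in avoid B X).
    rewrite inE negb_forall => /existsP[w]; rewrite negb_imply negbK.
    move=> /andP[wX fw]; apply/bigcupP; exists w; last by rewrite inE fw.
    rewrite /X1 inE wX andbT; apply: contraL fw => wX2.
    by move: fX2; rewrite inE => /forall_inP/(_ w wX2).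
  have c1 : (#|avoid B X2| <=
      #|avoid B X| + \sum_(w in X1) #|B w :&: avoid B X2|)%N.
    apply: leq_trans (subset_leq_card cov) _.
    apply: leq_trans (leq_card_setU _ _) _; rewrite leq_add2l.
    elim/big_ind2: _ => [|m1 P1 m2 P2 h h'|//]; first by rewrite cards0.
    by apply: leq_trans (leq_card_setU _ _) _; apply: leq_add.
  move: c1; rewrite -(ler_nat F) natrD natr_sum => c1.
  have c2 : \sum_(w in X1) #|B w :&: avoid B X2|%:R <=
      2 * p * D%:R * #|avoid B X2|%:R :> F.
    apply: (@le_trans _ _ (\sum_(w in X1) 2 * p * #|avoid B X2|%:R)).
      by apply: ler_sum => w _; apply: IH.
    rewrite sumr_const -[leLHS]mulr_natr [leLHS]mulrAC ler_wpM2r ?ler0n //.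
    by rewrite ler_wpM2l ?ler_nat // mulr_ge0.
  have := ler0n F #|avoid B X2|; set a := (#|avoid B X2|%:R : F) in c1 c2 *.
  set b := (\sum_(w in X1) _ : F) in c1 c2.
  nra.
rewrite [2 * p]mulrC -mulrA; apply: le_trans h1 _.
by rewrite ler_wpM2l.
Qed.

(** Adding the events one at a time, each discards at most a fraction 2p <= 1/2 of the functions
    left. The count bounded by [D] includes [v] itself when [S v] is nonempty. *)
Lemma local_lemma (F : realFieldType) (T A : finType)
    (B : T -> {set {ffun T -> A}}) (S : T -> {set T}) (D : nat) (p : F) :
  (0 < #|A|)%N -> (0 < D)%N ->
  (forall v (f g : {ffun T -> A}),
     {in S v, f =1 g} -> (f \in B v) = (g \in B v)) ->
  (forall v, #|[set w | ~~ [disjoint S v & S w]]| <= D)%N ->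
  (forall v, #|B v|%:R <= p * #|{ffun T -> A}|%:R) ->
  0 <= p -> 4 * p * D%:R <= 1 ->
  exists f : {ffun T -> A}, forall v, f \notin B v.
Proof.
move=> A0 D0 hS hD hp p0 hpD.
have p2 : 2 * p <= 2^-1.
  have D1 : 1 <= D%:R :> F by rewrite ler1n.
  nra.
suff h (s : seq T) : (0 < #|avoid B [set x in s]|)%N.
  have /card_gt0P[f] := h (enum T); rewrite inE => /forall_inP hf.
  by exists f => v; apply: hf; rewrite inE mem_enum.
elim: s => [|v s IH].
  apply/card_gt0P; have /card_gt0P[a _] := A0; exists [ffun=> a].
  by rewrite inE; apply/forall_inP => v; rewrite inE.
have := local_lemma_aux A0 hS hD hp p0 hpD [set x in s] v.
set X := [set x in s] in IH *; set Y := [set x in v :: s].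
have : avoid B X \subset avoid B Y :|: (B v :&: avoid B X).
  apply/subsetP => f fX; rewrite in_setU in_setI fX andbT.
  have [|fv] := boolP (f \in B v); first by rewrite orbT.
  rewrite orbF.
  rewrite inE; apply/forall_inP => w; rewrite inE in_cons.
  case/orP => [/eqP->//|ws].
  by move: fX; rewrite inE => /forall_inP; apply; rewrite inE.
move=> /subset_leq_card h.
have {h} := leq_trans h (leq_card_setU _ _).
rewrite -(ler_nat F) natrD; move: IH; rewrite -2!(ltr_nat F).
set a := #|avoid B X|%:R; set b := #|avoid B Y|%:R => a0 hab hc.
have : 2 * p * a <= 2^-1 * a by rewrite ler_wpM2r // ltW.
move: a0 hab hc; set c := 2 * p * a; lra.
Qed.

(** * Two-stage coloring *)

Lemma leq_card_bigcup (I T : finType) (P : pred I) (F : I -> {set T}) :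
  (#|\bigcup_(i | P i) F i| <= \sum_(i | P i) #|F i|)%N.
Proof.
elim/big_ind2: _ => [|m1 P1 m2 P2 h h'|//]; first by rewrite cards0.
by apply: leq_trans (leq_card_setU _ _) _; apply: leq_add.
Qed.

Lemma bernoulli_le (F : realFieldType) (x : F) (n : nat) :
  0 <= x <= 1 -> 1 - n%:R * x <= (1 - x) ^+ n.
Proof.
move=> /andP[x0 x1]; elim: n => [|n IH]; first by rewrite mul0r subr0 expr0.
rewrite exprS -natr1.
have : (1 - x) * (1 - n%:R * x) <= (1 - x) * (1 - x) ^+ n.
  by rewrite ler_wpM2l // subr_ge0.
by apply: le_trans; have := ler0n F n; nra.
Qed.

(** Coordinates are independent, so the proportion is a product of factors 1 - |S w|/|A|, each
    bounded by Bernoulli's inequality. *)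
Lemma card_ffun_avoid (F : realFieldType) (T A : finType) (S : T -> {set A}) :
  (0 < #|A|)%N ->
  #|[set f : {ffun T -> A} | [forall w, f w \notin S w]]|%:R <=
    (1 - #|A|%:R^-1) ^+ (\sum_w #|S w|) * #|{ffun T -> A}|%:R :> F.
Proof.
move=> A0; have A0' : 0 < #|A|%:R :> F by rewrite ltr0n.
have -> : #|[set f : {ffun T -> A} | [forall w, f w \notin S w]]| =
    (\prod_w (#|A| - #|S w|))%N.
  have e w : (#|A| - #|S w| = #|~: S w|)%N by rewrite [RHS]cardsCs setCK.
  under eq_bigr => w _ do rewrite e.
  have := card_family (fun w => mem (~: S w)) => {}e.
  transitivity #|[set x in family (fun w => mem (~: S w))]|.
    by apply: eq_card => f; rewrite !inE; apply: eq_forallb => w; rewrite !inE.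
  by rewrite cardsE e foldrE big_image.
rewrite card_ffun natrX -prodrXr -prodr_const -big_split /= natr_prod.
apply: ler_prod => w _; rewrite ler0n /= natrB ?max_card //.
have := @bernoulli_le F #|A|%:R^-1 #|S w|.
rewrite invr_ge0 ltW //= invf_le1 // ler1n A0 => /(_ isT).
move=> /(ler_wpM2r (ltW A0')); apply: le_trans.
by rewrite mulrBl mul1r mulfVK ?lt0r_neq0.
Qed.

Lemma nbhd_sym (T : finType) (G : sgraph T) (u v : T) :
  (u \in nbhd G v) = (v \in nbhd G u).
Proof. by rewrite !inE finset.setUC. Qed.

Definition missing (T A : finType) (G : sgraph T) (f : {ffun T -> A}) (v : T) :
  {set A} := ~: (f @: nbhd G v).

(* The colours that a new colour for u could supply to a neighbour of u. *)
Definition needed (T A : finType) (G : sgraph T) (f : {ffun T -> A}) (u : T) :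
  {set A} := \bigcup_(v in nbhd G u) missing G f v.

(* Pick for each c in C a neighbour phi c of u that misses c; then every w avoids
   the colours c with w adjacent to phi c. *)
Lemma card_sub_needed (F : realFieldType) (T A : finType) (G : sgraph T) d u
    (C : {set A}) : (0 < #|A|)%N -> regular d G ->
  #|[set f : {ffun T -> A} | C \subset needed G f u]|%:R <=
    (d%:R * (1 - #|A|%:R^-1) ^+ d) ^+ #|C| * #|{ffun T -> A}|%:R :> F.
Proof.
move=> A0 /forallP reg.
pose S (phi : {ffun A -> T}) w := [set c in C | w \in nbhd G (phi c)].
pose E phi := [set f : {ffun T -> A} | [forall w, f w \notin S phi w]].
have sub : [set f : {ffun T -> A} | C \subset needed G f u] \subset
    \bigcup_(phi in pffun_on u (mem C) (mem (nbhd G u))) E phi.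
  apply/subsetP => f; rewrite inE => /subsetP hf.
  (* The default [u] off [C] is the support condition of [pffun_on], which leaves d^|C| functions
     for the union bound. *)
  pose phi := [ffun c => if c \in C then
      odflt u [pick v in nbhd G u | c \in missing G f v] else u].
  have phiP c : c \in C -> phi c \in nbhd G u /\ c \in missing G f (phi c).
    move=> cC; rewrite ffunE cC; case: pickP => [v /andP[]//|] /= h.
    by have /bigcupP[v vu cv] := hf _ cC; have := h v; rewrite vu cv.
  apply/bigcupP; exists phi.
    apply/pffun_onP; split.
      by apply/supportP => c cC; rewrite ffunE (negbTE cC).
    by move=> _ /imageP[c cC ->]; have [] := phiP _ cC.
  rewrite inE; apply/forallP => w; rewrite inE; apply/negP => /andP[wC wn].
  have [_] := phiP _ wC; rewrite inE => /negP; apply; exact: imset_f.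
have cE (phi : {ffun A -> T}) :
    #|E phi|%:R <= (1 - #|A|%:R^-1) ^+ (d * #|C|) * #|{ffun T -> A}|%:R :> F.
  have := card_ffun_avoid F (S phi) A0; rewrite -/(E phi).
  suff -> : (\sum_w #|S phi w| = d * #|C|)%N by [].
  under eq_bigr => w _ do rewrite -sum1_card big_mkcond.
  rewrite exchange_big /= -[in RHS]sum1_card big_distrr /=.
  rewrite [RHS]big_mkcond; apply: eq_bigr => c _.
  case: ifP => cC; last by rewrite big1 // => w _; rewrite inE cC.
  rewrite muln1 -(eqP (reg (phi c))) -sum1_card [RHS]big_mkcond /=.
  by apply: eq_bigr => w _; rewrite [c \in _]inE cC.
apply: (@le_trans _ _ (\sum_(phi in pffun_on u (mem C) (mem (nbhd G u)))
    #|E phi|%:R)).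
  rewrite -natr_sum ler_nat; apply: leq_trans (subset_leq_card sub) _.
  exact: leq_card_bigcup.
apply: le_trans (ler_sum _ (fun phi _ => cE phi)) _.
rewrite sumr_const card_pffun_on (eqP (reg u)) exprMn -exprM -[leLHS]mulr_natl.
by rewrite natrX mulrA.
Qed.

(** Since 2^|L| counts the subsets of L, this exponential moment is a sum over [C] of the counts in
    [card_sub_needed], and the binomial theorem adds up their bounds. *)
Lemma sum_exp2_needed (F : realFieldType) (T A : finType) (G : sgraph T) d u :
  (0 < #|A|)%N -> regular d G ->
  \sum_(f : {ffun T -> A}) 2 ^+ #|needed G f u| <=
    (1 + d%:R * (1 - #|A|%:R^-1) ^+ d) ^+ #|A| * #|{ffun T -> A}|%:R :> F.
Proof.
move=> A0 reg.
have -> : \sum_(f : {ffun T -> A}) 2 ^+ #|needed G f u| =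
  \sum_(C : {set A}) #|[set f : {ffun T -> A} | C \subset needed G f u]|%:R :> F.
  under [RHS]eq_bigr => C _ do rewrite -sum1_card natr_sum big_mkcond.
  rewrite exchange_big /=; apply: eq_bigr => f _.
  rewrite -natrX -card_powerset -sum1_card natr_sum big_mkcond /=.
  by apply: eq_bigr => C _; rewrite !inE.
apply: le_trans (ler_sum _ (fun C _ => card_sub_needed F u C A0 reg)) _.
rewrite -mulr_suml ler_wpM2r ?ler0n //.
set y := d%:R * _.
have -> : (1 + y) ^+ #|A| = \prod_(c : A) (y + 1) by rewrite prodr_const addrC.
rewrite bigA_distr /=.
by apply: ler_sum => C _; rewrite -big_mkcond /= prodr_const.
Qed.

(** Markov's inequality for the exponential moment bounds each bad event. The event at [u] reads
    only the ends of walks of length two from [u], so dependent events are joined by walks of length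
    four: at most d^4 of them. *)
Lemma few_needed (F : realFieldType) (T A : finType) (G : sgraph T) d m :
  (0 < #|A|)%N -> (0 < d)%N -> regular d G ->
  4 * ((1 + d%:R * (1 - #|A|%:R^-1) ^+ d) ^+ #|A| / 2 ^+ m) * (d ^ 4)%:R
    <= 1 :> F ->
  exists f : {ffun T -> A}, forall u, (#|needed G f u| <= m)%N.
Proof.
move=> A0 d0 reg; set p := _ / _ => hp.
pose B u := [set f : {ffun T -> A} | (m < #|needed G f u|)%N].
pose S u := \bigcup_(v in nbhd G u) nbhd G v.
have cU (X : {set T}) : (#|\bigcup_(v in X) nbhd G v| <= #|X| * d)%N.
  apply: leq_trans (leq_card_bigcup _ _) _.
  rewrite -sum_nat_const; apply: leq_sum => v _.
  by rewrite (eqP (forallP reg v)).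
have [|||||||f hf] := @local_lemma F T A B S (d ^ 4) p => //.
- by rewrite expn_gt0 d0.
- move=> v f g fg; rewrite !inE; congr (m < #|pred_of_set _|)%N.
  apply: eq_bigr => w wv; congr (~: _); apply: eq_in_imset => x xw.
  by apply: fg; apply/bigcupP; exists w.
- move=> v; pose N (X : {set T}) := \bigcup_(v in X) nbhd G v.
  apply: (@leq_trans #|N (N (N (nbhd G v)))|).
    apply/subset_leq_card/subsetP => w; rewrite inE.
    move=> /pred0Pn[x /andP[/= /bigcupP[y yv xy] /bigcupP[z zw xz]]].
    apply/bigcupP; exists z; last by rewrite nbhd_sym.
    apply/bigcupP; exists x; last by rewrite nbhd_sym.
    by apply/bigcupP; exists y.
  rewrite (_ : d ^ 4 = d * d * d * d)%N; last by rewrite !expnS muln1 !mulnA.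
  apply: leq_trans (cU _) _; rewrite leq_mul2r; apply/orP; right.
  apply: leq_trans (cU _) _; rewrite leq_mul2r; apply/orP; right.
  apply: leq_trans (cU _) _; rewrite leq_mul2r; apply/orP; right.
  by rewrite (eqP (forallP reg v)).
- move=> v; rewrite /p mulrAC ler_pdivlMr ?exprn_gt0 //.
  apply: le_trans (sum_exp2_needed F v A0 reg).
  rewrite -sum1_card natr_sum mulr_suml big_mkcond /=; apply: ler_sum => f _.
  rewrite inE; case: ifP => [h|_]; last by rewrite exprn_ge0.
  by rewrite mul1r ler_weXn2l ?ler1n // ltnW.
- rewrite divr_ge0 ?exprn_ge0 // addr_ge0 // mulr_ge0 // exprn_ge0 //.
  by rewrite subr_ge0 invf_le1 ?ler1n ?ltr0n.
by exists f => u; have := hf u; rewrite inE -leqNgt.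
Qed.

(** The numerical hypotheses are the local lemma conditions of the two stages. In the second, the
    factor [k] is a union bound over missing colours, and the event at a vertex reads only its
    neighbours, whence d^2. *)
Lemma two_stage_coloring (F : realFieldType) (T : finType) (G : sgraph T)
    (d k r m : nat) :
  (0 < k)%N -> (0 < d)%N -> (0 < m)%N -> regular d G ->
  4 * ((1 + d%:R * (1 - (k + r)%:R^-1) ^+ d) ^+ (k + r) / 2 ^+ m)
    * (d ^ 4)%:R <= 1 :> F ->
  4 * (k%:R * (1 - m%:R^-1) ^+ (r - m)) * (d ^ 2)%:R <= 1 :> F ->
  coupon_colorable G k.
Proof.
move=> k0 d0 m0 reg h1 h2.
pose A : finType := ('I_k + 'I_r)%type.
have cA : #|A| = (k + r)%N by rewrite card_sum !card_ord.
have [||||f hf] := @few_needed F T A G d m; rewrite ?cA ?addn_gt0 ?k0 //.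
pose M v := [set i : 'I_k | inl i \in missing G f v].
pose L w := [set i : 'I_k | inl i \in needed G f w].
have nb v : exists u, u \in nbhd G v.
  by apply/card_gt0P; rewrite (eqP (forallP reg v)).
have missP v : (#|missing G f v| <= m)%N.
  have [u uv] := nb v; apply: leq_trans (hf u); apply/subset_leq_card/subsetP.
  by move=> c cv; apply/bigcupP; exists v; rewrite // nbhd_sym.
have ML v w i : w \in nbhd G v -> i \in M v -> i \in L w.
  rewrite [i \in M v]in_set [i \in L w]in_set => wv iv.
  by apply/bigcupP; exists v; rewrite // nbhd_sym.
have Lm w : (#|L w| <= m)%N.
  apply: leq_trans (hf w); rewrite -(card_imset _ (@inl_inj 'I_k 'I_r)).
  apply/subset_leq_card/subsetP => _ /imsetP[i iL ->]; by rewrite inE in iL.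
pose spare v w := (w \in nbhd G v) && (if f w is inr _ then true else false).
(* A spare vertex draws a position in the enumeration of [L w], so the single alphabet ['I_m] serves
   lists of all lengths. [P v i w] holds the one position that turns [w] into colour [i]. *)
pose P v i w : {set 'I_m} := if spare v w then
  [set j : 'I_m | val j == index i (enum (L w))] else set0.
pose B v := \bigcup_(i in M v) [set g : {ffun T -> 'I_m} |
  [forall w, g w \notin P v i w]].
(* Distinct spare colours seen by [v] sit on distinct neighbours, and [v] misses at most [m] of the
   [r]. *)
have cP v i : i \in M v -> (r - m <= \sum_w #|P v i w|)%N.
  move=> iM.
  have e w : #|P v i w| = spare v w.
    rewrite /P; case: ifP => [/andP[wv _]|_]; last by rewrite cards0.
    have lt : (index i (enum (L w)) < m)%N.
      apply: leq_trans (Lm w); rewrite cardE index_mem mem_enum.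
      exact: ML wv iM.
    rewrite /= -(cards1 (Ordinal lt)); apply: eq_card => j.
    by rewrite !inE -val_eqE.
  under eq_bigr => w _ do rewrite e.
  rewrite -big_mkcond /= sum1dep_card leq_subLR.
  pose Q := [set x : 'I_r | inr x \in missing G f v].
  have : (#|Q| <= m)%N.
    apply: leq_trans (missP v); rewrite -(card_imset _ (@inr_inj 'I_k 'I_r)).
    apply/subset_leq_card/subsetP => _ /imsetP[x xQ ->]; by rewrite inE in xQ.
  have : (#|~: Q| <= #|[set w | spare v w]|)%N.
    rewrite -(card_imset _ (@inr_inj 'I_k 'I_r)).
    apply: leq_trans (leq_imset_card f _).
    apply/subset_leq_card/subsetP => _ /imsetP[x xQ ->].
    move: xQ; rewrite !inE negbK => /imsetP[w wv fw].
    by apply/imsetP; exists w; rewrite // inE /spare wv -fw.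
  have := cardsC Q; rewrite card_ord; lia.
have m1 : 0 <= (1 - m%:R^-1 : F) <= 1.
  by rewrite subr_ge0 invf_le1 ?ler1n ?ltr0n // m0 gerBl invr_ge0 ler0n.
have cB v : #|B v|%:R <=
    k%:R * (1 - m%:R^-1) ^+ (r - m) * #|{ffun T -> 'I_m}|%:R :> F.
  apply: (@le_trans _ _ (\sum_(i in M v)
      #|[set g : {ffun T -> 'I_m} | [forall w, g w \notin P v i w]]|%:R)).
    by rewrite -natr_sum ler_nat leq_card_bigcup.
  apply: (@le_trans _ _ (\sum_(i in M v)
      (1 - m%:R^-1) ^+ (r - m) * #|{ffun T -> 'I_m}|%:R)).
    apply: ler_sum => i iM.
    have := @card_ffun_avoid F T 'I_m (P v i); rewrite card_ord => /(_ m0).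
    move/le_trans; apply; rewrite ler_wpM2r ?ler0n //.
    by case/andP: m1 => *; rewrite ler_wiXn2l // cP.
  rewrite sumr_const -[leLHS]mulr_natl mulrA ler_wpM2r ?ler0n //.
  rewrite ler_wpM2r ?exprn_ge0 ?ler_nat //; first by case/andP: m1.
  by rewrite -[k in (_ <= k)%N]card_ord max_card.
have [||||||g hg] := @local_lemma F T 'I_m B (nbhd G) (d ^ 2) _ _ _ _ _ cB.
- by rewrite card_ord.
- by rewrite expn_gt0 d0.
- move=> v g g' gg'; apply/bigcupP/bigcupP => -[i iM]; rewrite inE => /forallP h;
    exists i => //; rewrite inE; apply/forallP => w; have := h w;
    rewrite /P /spare; have [wv|_] := boolP (w \in nbhd G v);
    by [rewrite gg' | rewrite !inE].
- move=> v; apply: (@leq_trans #|\bigcup_(x in nbhd G v) nbhd G x|).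
    apply/subset_leq_card/subsetP => w; rewrite inE => /pred0Pn[x /andP[/= xv xw]].
    by apply/bigcupP; exists x; rewrite // nbhd_sym.
  apply: leq_trans (leq_card_bigcup _ _) _.
  rewrite (eq_bigr (fun=> d)); last by move=> w _; rewrite (eqP (forallP reg w)).
  by rewrite sum_nat_const (eqP (forallP reg v)) mulnn.
- by case/andP: m1 => *; rewrite mulr_ge0 ?exprn_ge0 ?ler0n.
- exact: h2.
pose i0 := Ordinal k0.
(* Positions past the end of the list yield the default [i0]. This is harmless: kept colours are
   never overwritten, and missing ones are supplied by valid positions. *)
pose c := [ffun w => if f w is inl i then i else nth i0 (enum (L w)) (g w)].
apply/existsP; exists c; apply/forallP => v; apply/forallP => i.
have [iM|] := boolP (i \in M v).
  have : g \notin [set g : {ffun T -> 'I_m} | [forall w, g w \notin P v i w]].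
    by apply: contra (hg v) => gv; apply/bigcupP; exists i.
  rewrite inE negb_forall => /existsP[w]; rewrite negbK /P.
  case: ifP => [/andP[wv fw]|]; last by rewrite inE.
  rewrite inE => /eqP gw; apply/existsP; exists w; rewrite wv /= ffunE.
  case: (f w) fw => // _ _; rewrite gw nth_index // mem_enum.
  exact: ML wv iM.
rewrite !inE negbK => /imsetP[w wv fw].
by apply/existsP; exists w; rewrite wv /= ffunE -fw.
Qed.

(** * Switchings *)

Lemma sgraph_ext (T : finType) (G H : sgraph T) :
  nbhd G =1 nbhd H -> G = H.
Proof.
move=> GH; apply: val_inj => /=; apply/setP => E.
have [/cards2P[x [y [_ ->]]]|nE] := boolP (#|E| == 2).
  by have /setP/(_ y) := GH x; rewrite !inE.
have h (K : sgraph T) : (E \in edges K) = false.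
  apply: contraNF nE => EK; by case: K EK => K /= /forall_inP; apply.
by rewrite !h.
Qed.

Definition graph_edges (T : finType) (e : rel T) : {set {set T}} :=
  [set E | [exists x, exists y, [&& x != y, e x y & E == [set x; y]]]].

Lemma graph_edgesP (T : finType) (e : rel T) :
  [forall E in graph_edges e, #|E| == 2].
Proof.
apply/forall_inP => E; rewrite inE.
by move=> /existsP[x /existsP[y /and3P[xy _ /eqP->]]]; rewrite cards2 xy.
Qed.

Definition graph_of (T : finType) (e : rel T) := SGraph (graph_edgesP e).

Lemma nbhd_graph_of (T : finType) (e : rel T) x y :
  symmetric e -> irreflexive e -> (y \in nbhd (graph_of e) x) = e x y.
Proof.
move=> es ei; rewrite !inE.
apply/existsP/idP => [[x' /existsP[y' /and3P[n exy /eqP/setP E]]]|exy].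
  have /set2P hx : x \in [set x'; y'] by rewrite -E set21.
  have /set2P hy : y \in [set x'; y'] by rewrite -E set22.
  have hx' : x' \in [set x; y] by rewrite E set21.
  have hy' : y' \in [set x; y] by rewrite E set22.
  case: hx hy hx' hy' => -> [] -> //; last 2 first.
  - by rewrite es.
  - by rewrite !inE !orbb (negbTE n).
  - by rewrite !inE !orbb [y' == _]eq_sym (negbTE n).
exists x; apply/existsP; exists y; rewrite exy eqxx !andbT.
by apply: contraTneq exy => ->; rewrite ei.
Qed.

(** Adjacency in the 4-cycle v, u, b, a. Taking the symmetric difference with it performs the
    switching when vu and ab are edges and va and ub are not. *)
Definition cycle4 (T : finType) (v u a b x y : T) :=
  [|| (x == v) && ((y == u) || (y == a)), (x == u) && ((y == v) || (y == b)),
      (x == a) && ((y == v) || (y == b)) | (x == b) && ((y == u) || (y == a))].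

(* Trades the edges vu and ab for va and ub. *)
Definition switch (T : finType) (G : sgraph T) (v u a b : T) : sgraph T :=
  graph_of (fun x y => (y \in nbhd G x) (+) cycle4 v u a b x y).

(** The two inequalities keep the new edges from being loops; the other distinctness facts follow,
    see [switchable_neq]. *)
Definition switchable (T : finType) (G : sgraph T) (v u a b : T) :=
  [&& u \in nbhd G v, b \in nbhd G a, a \notin nbhd G v, b \notin nbhd G u,
      a != v & b != u].

Lemma cycle4_sym (T : finType) (v u a b : T) : symmetric (cycle4 v u a b).
Proof.
move=> x y; rewrite /cycle4.
by case: (x == v); case: (x == u); case: (x == a); case: (x == b);
   case: (y == v); case: (y == u); case: (y == a); case: (y == b).
Qed.

Lemma nbhd_switch (T : finType) (G : sgraph T) (v u a b x y : T) :
  v != u -> a != b -> v != a -> u != b ->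
  (y \in nbhd (switch G v u a b) x) =
    (y \in nbhd G x) (+) cycle4 v u a b x y.
Proof.
move=> vu ab va ub; apply: nbhd_graph_of => [z w|z].
  by rewrite nbhd_sym cycle4_sym.
rewrite (negbTE (nbhd_irr G z)) /cycle4 /=.
have [->|_] := eqVneq z v; rewrite ?(negbTE vu) ?(negbTE va) ?andbF ?orbF //=.
have [->|_] := eqVneq z u; rewrite ?(negbTE ub) ?andbF ?orbF //=.
by have [->|_] := eqVneq z a; rewrite ?(negbTE ab) ?andbF.
Qed.

Lemma switchable_neq (T : finType) (G : sgraph T) (v u a b : T) :
  switchable G v u a b ->
  [/\ v != u, a != b, v != a & u != b] /\ (v != b /\ u != a).
Proof.
case/and5P => uv ba av bu /andP[nav nbu].
have irr := nbhd_irr G.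
do ?split; rewrite 1?eq_sym //.
- by apply: contraTneq uv => ->.
- by apply: contraTneq ba => ->.
- by apply: contraNneq bu => ->; rewrite nbhd_sym.
- by apply: contraNneq av => ->.
Qed.

(** Adding a fixed 4-cycle modulo 2 can be cancelled. This gives injectivity in the double count. *)
Lemma switch_inj (T : finType) (G H : sgraph T) (v u a b : T) :
  switchable G v u a b -> switch G v u a b = switch H v u a b -> G = H.
Proof.
move=> /switchable_neq[[vu ab va ub] _] e; apply: sgraph_ext => x.
apply/setP => y; have := nbhd_switch G x y vu ab va ub.
by rewrite e nbhd_switch // => /addIb.
Qed.

Lemma nbhd_switch_v (T : finType) (G : sgraph T) (v u a b : T) :
  switchable G v u a b ->
  nbhd (switch G v u a b) v = a |: nbhd G v :\ u.
Proof.
move=> sw; have [[vu ab va ub] [vb ua]] := switchable_neq sw.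
case/and5P: sw => uv ba av bu /andP[nav nbu].
apply/setP => y; rewrite nbhd_switch // /cycle4 eqxx /= in_setU1 in_setD1.
rewrite (negbTE vu) (negbTE va) (negbTE vb) !orbF.
have [->|_] := eqVneq y a; first by rewrite (negbTE av) orbT.
by rewrite orbF; have [->|_] := eqVneq y u; rewrite ?uv // addbF.
Qed.

(** With [switch_rev], this symmetry of the 4-cycle reduces the new neighbourhoods of [u], [a] and
    [b] to that of [v]. *)
Lemma switch_sym (T : finType) (G : sgraph T) (v u a b : T) :
  switchable G v u a b ->
  switchable G u v b a /\ switch G u v b a = switch G v u a b.
Proof.
move=> sw; have [[vu ab va ub] [vb ua]] := switchable_neq sw; split.
  case/and5P: sw => uv ba av bu /andP[nav nbu].
  by rewrite /switchable nbhd_sym uv nbhd_sym ba av bu nav nbu.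
apply: sgraph_ext => x; apply/setP => y.
rewrite !nbhd_switch // 1?eq_sym // /cycle4; congr (_ (+) _).
by case: (x == v); case: (x == u); case: (x == a); case: (x == b);
   case: (y == v); case: (y == u); case: (y == a); case: (y == b).
Qed.

Lemma switch_rev (T : finType) (G : sgraph T) (v u a b : T) :
  switchable G v u a b ->
  switchable G a b v u /\ switch G a b v u = switch G v u a b.
Proof.
move=> sw; have [[vu ab va ub] [vb ua]] := switchable_neq sw; split.
  case/and5P: sw => uv ba av bu /andP[nav nbu].
  by rewrite /switchable ba uv nbhd_sym av nbhd_sym bu eq_sym nav eq_sym nbu.
apply: sgraph_ext => x; apply/setP => y.
rewrite !nbhd_switch // 1?eq_sym // /cycle4; congr (_ (+) _).
by case: (x == v); case: (x == u); case: (x == a); case: (x == b);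
   case: (y == v); case: (y == u); case: (y == a); case: (y == b).
Qed.

Lemma nbhd_switch_a (T : finType) (G : sgraph T) (v u a b : T) :
  switchable G v u a b ->
  nbhd (switch G v u a b) a = v |: nbhd G a :\ b.
Proof. by move=> /switch_rev[sw <-]; rewrite nbhd_switch_v. Qed.

Lemma nbhd_switch_u (T : finType) (G : sgraph T) (v u a b : T) :
  switchable G v u a b ->
  nbhd (switch G v u a b) u = b |: nbhd G u :\ v.
Proof. by move=> /switch_sym[sw <-]; rewrite nbhd_switch_v. Qed.

Lemma nbhd_switch_b (T : finType) (G : sgraph T) (v u a b : T) :
  switchable G v u a b ->
  nbhd (switch G v u a b) b = u |: nbhd G b :\ a.
Proof. by move=> /switch_rev[sw <-]; rewrite nbhd_switch_u. Qed.

Lemma nbhd_switch_id (T : finType) (G : sgraph T) (v u a b x : T) :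
  switchable G v u a b -> x != v -> x != u -> x != a -> x != b ->
  nbhd (switch G v u a b) x = nbhd G x.
Proof.
move=> /switchable_neq[[vu ab va ub] _] xv xu xa xb; apply/setP => y.
rewrite nbhd_switch // /cycle4 (negbTE xv) (negbTE xu) (negbTE xa) (negbTE xb).
by rewrite addbF.
Qed.

Lemma cardsU1D1 (T : finType) (X : {set T}) (p q : T) :
  p \in X -> q \notin X -> #|q |: X :\ p| = #|X|.
Proof.
move=> pX qX; rewrite cardsU1 in_setD1 (negbTE qX) andbF.
by rewrite [RHS](cardsD1 p) pX.
Qed.

Lemma regular_switch (T : finType) (G : sgraph T) d (v u a b : T) :
  switchable G v u a b -> regular d G -> regular d (switch G v u a b).
Proof.
move=> sw /forallP reg; apply/forallP => x.
have /and5P[uv ba av bu _] := sw.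
have [->|xv] := eqVneq x v; first by rewrite nbhd_switch_v // cardsU1D1.
have [->|xu] := eqVneq x u.
  by rewrite nbhd_switch_u // cardsU1D1 // nbhd_sym.
have [->|xa] := eqVneq x a.
  by rewrite nbhd_switch_a // cardsU1D1 // nbhd_sym.
have [->|xb] := eqVneq x b; last by rewrite nbhd_switch_id.
by rewrite nbhd_switch_b // cardsU1D1 // nbhd_sym.
Qed.

(** * Double counting of switchings *)

Lemma card_pairs (A B : finType) (P : {set A}) (Q : A -> {set B}) :
  #|[set p : A * B | (p.1 \in P) && (p.2 \in Q p.1)]| =
  (\sum_(x in P) #|Q x|)%N.
Proof.
under [RHS]eq_bigr => x _ do rewrite -sum1_card.
rewrite pair_big_dep /= -sum1_card; apply: eq_bigl => p; by rewrite inE.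
Qed.

Definition undominated (T : finType) (S : {set T}) (G : sgraph T) : {set T} :=
  [set x in ~: S | [disjoint nbhd G x & S]].

(* Pairs (G, v): v lies outside S and has j neighbours in S, and t vertices other
   than v are undominated. *)
Definition rooted (T : finType) (d : nat) (S : {set T}) (t j : nat) :
    {set sgraph T * T} :=
  [set p | [&& regular d p.1, p.2 \notin S, #|nbhd p.1 p.2 :&: S| == j
    & #|undominated S p.1 :\ p.2| == t]].

(** The switching gives b the neighbour [u] in [S]; requiring b to be dominated beforehand keeps the
    undominated set unchanged apart from [v]. *)
Definition swap_edges (T : finType) (S : {set T}) (G : sgraph T) (v u : T) :
    {set T * T} :=
  [set p | [&& switchable G v u p.1 p.2, p.1 \notin S, p.2 \notin S
    & ~~ [disjoint nbhd G p.2 & S]]].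

(** Of the d|T| oriented edges ab, discard those with a among [v], [S] and the neighbours of [v], or
    b in [S], adjacent to [u], or undominated and not [v]. Each excluded vertex costs d edges. *)
Lemma card_swap_edges (T : finType) d (S : {set T}) t (G : sgraph T) v u :
  regular d G -> u \in nbhd G v -> u \in S -> #|undominated S G :\ v| = t ->
  (d * (#|T| - 2 * #|S| - t - 2 * d - 1) <= #|swap_edges S G v u|)%N.
Proof.
move=> /forallP reg uv uS tE.
pose X := v |: (S :|: nbhd G v).
pose Y := S :|: nbhd G u :|: (undominated S G :\ v).
pose E1 := [set p : T * T | (p.1 \in X) && (p.2 \in nbhd G p.1)].
pose E2 := [set p : T * T | (p.1 \in Y) && (p.2 \in nbhd G p.1)].
pose E := [set p : T * T | (p.1 \in [set: T]) && (p.2 \in nbhd G p.1)].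
pose sw (p : T * T) := (p.2, p.1).
have swK : involutive sw by case.
have cE (Z : {set T}) :
    (#|[set p : T * T | (p.1 \in Z) && (p.2 \in nbhd G p.1)]| = #|Z| * d)%N.
  rewrite card_pairs -sum_nat_const; apply: eq_bigr => x _.
  by rewrite (eqP (reg x)).
have cX : (#|X| <= 1 + (#|S| + d))%N.
  rewrite /X cardsU1; apply: leq_add; first by case: (_ \notin _).
  by apply: leq_trans (leq_card_setU _ _) _; rewrite (eqP (reg v)).
have cY : (#|Y| <= #|S| + d + t)%N.
  apply: leq_trans (leq_card_setU _ _) _; rewrite tE leq_add2r.
  by apply: leq_trans (leq_card_setU _ _) _; rewrite (eqP (reg u)).
have sub : E \subset swap_edges S G v u :|: E1 :|: sw @: E2.
  apply/subsetP => -[a b]; rewrite [_ \in E]in_set => /andP[_ /= ab].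
  rewrite in_setU in_setU.
  have [aX|aX] := boolP (a \in X); first by rewrite [_ \in E1]in_set /= aX ab orbT.
  have [bY|bY] := boolP (b \in Y).
    apply/orP; right; apply/imsetP; exists (b, a) => //.
    by rewrite [_ \in E2]in_set /= bY nbhd_sym.
  apply/orP; left; apply/orP; left; rewrite [_ \in _]in_set /=.
  move: aX bY; rewrite !in_setU in_set1 in_setD1 !negb_or.
  move=> /and3P[av aS nav] /andP[/andP[bS nbu] bu].
  have nb : b != v by apply: contraNneq nbu => ->; rewrite nbhd_sym.
  rewrite /switchable uv ab nav nbu av aS bS /=.
  rewrite (_ : b != u); last by apply: contraNneq bS => ->.
  apply: contra bu => h; rewrite nb [_ \in undominated _ _]in_set h.
  by rewrite in_setC bS.
have := leq_trans (subset_leq_card sub) (leq_card_setU _ _).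
have := leq_of_leqif (leq_card_setU (swap_edges S G v u) E1).
rewrite (card_imset _ (inv_inj swK)) !cE cardsT => h1 h2.
have hx : (#|X| * d <= (1 + (#|S| + d)) * d)%N by rewrite leq_mul2r cX orbT.
have hy : (#|Y| * d <= (#|S| + d + t) * d)%N by rewrite leq_mul2r cY orbT.
move: #|_ :|: E1| #|swap_edges _ _ _ _| h1 h2 => c1 c2 h1 h2.
move: #|X| #|Y| hx hy h1 h2 => x y hx hy h1 h2 {X Y E E1 E2 cE cX cY sub}.
move: #|T| #|S| h1 h2 hx hy => n s h1 h2 hx hy.
have [le|gt] := leqP n (2 * s + t + 2 * d + 1).
  by rewrite (_ : n - 2 * s - t - 2 * d - 1 = 0)%N ?muln0 //; lia.
have -> : (n - 2 * s - t - 2 * d - 1 = n - (2 * s + t + 2 * d + 1))%N by lia.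
rewrite mulnC mulnBl leq_subLR.
have : (n * d <= c2 + (1 + (s + d)) * d + (s + d + t) * d)%N.
  by lia.
by rewrite -addnA -mulnDl addnC; congr (_ <= _ * _ + _)%N; lia.
Qed.

(** The root trades [u] in [S] for [a] outside; [a] trades [b] for [v], both outside [S]; [b] was
    and stays dominated. The last two conclusions feed the reverse count. *)
Lemma switch_rooted (T : finType) d (S : {set T}) t j (G : sgraph T) v u a b :
  (G, v) \in rooted d S t j.+1 -> u \in nbhd G v :&: S ->
  (a, b) \in swap_edges S G v u ->
  [/\ (switch G v u a b, v) \in rooted d S t j,
      a \in nbhd (switch G v u a b) v :\: S
    & b \in nbhd (switch G v u a b) u].
Proof.
rewrite [_ \in rooted _ _ _ _]in_set /= => /and4P[reg vS jE tE].
rewrite in_setI => /andP[uv uS].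
rewrite [_ \in swap_edges _ _ _ _]in_set /= => /and4P[sw aS bS bd].
have [[vu ab va ub] [vb ua]] := switchable_neq sw.
split; first last.
- by rewrite nbhd_switch_u // setU11.
- by rewrite in_setD aS nbhd_switch_v // setU11.
rewrite in_set /=; apply/and4P; split=> //; first exact: regular_switch.
  have -> : nbhd (switch G v u a b) v :&: S = (nbhd G v :&: S) :\ u.
    apply/setP => y; rewrite nbhd_switch_v // !inE.
    by have [->|_] := eqVneq y a; rewrite ?(negbTE aS) ?andbF // andbA.
  by have := cardsD1 u (nbhd G v :&: S); rewrite in_setI uv uS (eqP jE) => -[->].
rewrite -(eqP tE); apply/eqP; congr #|pred_of_set _|.
apply/setP => x; rewrite !in_setD1; have [//|xv /=] := eqVneq x v.
rewrite ![_ \in undominated _ _]in_set; have [|xS] := boolP (x \in S).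
  by rewrite in_setC => ->.
congr (_ && _).
have xu : x != u by apply: contraNneq xS => ->.
have [->|xa] := eqVneq x a.
  rewrite nbhd_switch_a // -!setI_eq0; congr (_ == set0); apply/setP => y.
  rewrite !in_setI in_setU1 in_setD1; have [yS|] := boolP (y \in S); last first.
    by rewrite !andbF.
  have -> : (y == v) = false by apply: contraTF yS => /eqP->.
  by have -> : y != b by apply: contraTneq yS => ->.
have [->|xb] := eqVneq x b; last by rewrite nbhd_switch_id.
rewrite (negbTE bd); apply/negbTE/pred0Pn; exists u.
by rewrite /= nbhd_switch_b // setU11.
Qed.

(** Forwards there are j + 1 choices of u, each with the edges of [card_swap_edges]. Backwards, a is
    one of d - j neighbours of v outside [S], u lies in [S], and b is one of the d neighbours of
    u. *)
Lemma leq_card_rooted_step (T : finType) d (S : {set T}) t j :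
  (#|rooted d S t j.+1| * (j.+1 * (d * (#|T| - 2 * #|S| - t - 2 * d - 1))) <=
    #|rooted d S t j| * ((d - j) * (#|S| * d)))%N.
Proof.
pose forward (p : sgraph T * T) := [set r : T * (T * T) |
  (r.1 \in nbhd p.1 p.2 :&: S) && (r.2 \in swap_edges S p.1 p.2 r.1)].
pose ends (p : sgraph T * T) (a : T) := [set ub : T * T |
  (ub.1 \in S) && (ub.2 \in nbhd p.1 ub.1)].
pose backward (p : sgraph T * T) := [set r : T * (T * T) |
  (r.1 \in nbhd p.1 p.2 :\: S) && (r.2 \in ends p r.1)].
pose X := [set q : (sgraph T * T) * (T * (T * T)) |
  (q.1 \in rooted d S t j.+1) && (q.2 \in forward q.1)].
pose Y := [set q : (sgraph T * T) * (T * (T * T)) |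
  (q.1 \in rooted d S t j) && (q.2 \in backward q.1)].
pose phi (q : (sgraph T * T) * (T * (T * T))) :=
  let: ((G, v), (u, (a, b))) := q in ((switch G v u a b, v), (a, (u, b))).
have XY : (#|X| <= #|Y|)%N.
  rewrite -(@card_in_imset _ _ phi).
    apply/subset_leq_card/subsetP => _ /imsetP[[[G v] [u [a b]]] qX ->].
    move: qX; rewrite [_ \in X]in_set => /andP[/= Gv].
    rewrite in_set => /andP[/= uvS abS].
    have [h1 h2 h3] := switch_rooted Gv uvS abS.
    rewrite [_ \in Y]in_set /= h1 in_set /= h2 in_set /= h3 andbT.
    by move: uvS; rewrite in_setI => /andP[].
  move=> [[G v] [u [a b]]] [[G' v'] [u' [a' b']]] qX _ /= /eqP.
  rewrite !xpair_eqE => /andP[/andP[/eqP e /eqP ev] /and3P[/eqP ea /eqP eu /eqP eb]].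
  move: e; rewrite -{}ev -{}ea -{}eu -{}eb => e.
  move: qX; rewrite [_ \in X]in_set => /andP[_ /=]; rewrite in_set => /andP[_ /=].
  rewrite [_ \in swap_edges _ _ _ _]in_set /= => /andP[sw _].
  by rewrite (switch_inj sw e).
apply: (@leq_trans #|X|).
  rewrite card_pairs -sum_nat_const; apply: leq_sum => -[G v] Gv.
  move: (Gv); rewrite [_ \in rooted _ _ _ _]in_set /=.
  move=> /and4P[reg vS /eqP jE /eqP tE].
  rewrite card_pairs -{1}jE -sum_nat_const; apply: leq_sum => u.
  by rewrite in_setI => /andP[uv uS]; apply: card_swap_edges.
apply: (leq_trans XY).
rewrite card_pairs -sum_nat_const; apply: leq_sum => -[G v].
rewrite [_ \in rooted _ _ _ _]in_set /= => /and4P[/forallP reg vS /eqP jE _].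
rewrite card_pairs (eq_bigr (fun=> #|S| * d)%N) => [|a _].
  by rewrite sum_nat_const cardsD jE (eqP (reg v)).
rewrite card_pairs -sum_nat_const; apply: eq_bigr => u _; exact/eqP/reg.
Qed.

(** Iterating the step, the ratios (d - j)/(j + 1) multiply to the binomial coefficient. *)
Lemma leq_card_rooted (T : finType) d (S : {set T}) t j : (0 < d)%N ->
  (#|rooted d S t j| * (#|T| - 2 * #|S| - t - 2 * d - 1) ^ j <=
    #|rooted d S t 0| * ('C(d, j) * #|S| ^ j))%N.
Proof.
move=> d0; elim: j => [|j IH]; first by rewrite bin0 !expn0 !muln1.
have := leq_card_rooted_step d S t j.
move: IH (mul_bin_left d j); set M := (_ - 1)%N; rewrite !expnS.
move: #|rooted _ _ _ j.+1| #|rooted _ _ _ j| #|rooted _ _ _ 0| #|S|.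
move: 'C(d, j.+1) 'C(d, j) (M ^ j)%N => c1 c0 Mj p1 p0 q s; move: (s ^ j)%N.
move=> sj IH bE st.
have {}st : (p1 * (j.+1 * M) <= p0 * ((d - j) * s))%N.
  rewrite -(leq_pmul2r d0); apply: leq_trans (leq_trans st _); lia.
rewrite -(@leq_pmul2l j.+1) //.
apply: (@leq_trans (p0 * ((d - j) * s) * Mj)).
  by rewrite (_ : _ * _ = p1 * (j.+1 * M) * Mj)%N ?leq_mul2r ?st ?orbT //; lia.
apply: (@leq_trans (q * (c0 * sj) * ((d - j) * s))).
  by rewrite (_ : _ * _ = p0 * Mj * ((d - j) * s))%N ?leq_mul2r ?IH ?orbT //; lia.
have -> : (j.+1 * (q * (c1 * (s * sj))) = q * s * sj * (j.+1 * c1))%N by lia.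
by rewrite bE; lia.
Qed.

Definition undominated_graphs (T : finType) (d : nat) (S : {set T}) (t : nat) :
    {set sgraph T} :=
  [set G | regular d G && (#|undominated S G| == t)].

(** A root without neighbours in [S] is itself undominated, hence one of t + 1 such vertices. *)
Lemma card_rooted0 (T : finType) d (S : {set T}) t :
  #|rooted d S t 0| = (t.+1 * #|undominated_graphs d S t.+1|)%N.
Proof.
transitivity #|[set p : sgraph T * T | (p.1 \in undominated_graphs d S t.+1) &&
    (p.2 \in undominated S p.1)]|.
  apply: eq_card => -[G v]; rewrite !in_set /= cards_eq0 setI_eq0.
  case: (regular d G) => //=; case: (boolP (v \in S)) => //=; rewrite ?andbF //.
  move=> vS; case: (boolP [disjoint _ & _]) => dv; rewrite ?andbF //= andbT.
  have vu : v \in undominated S G by rewrite !in_set vS.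
  by rewrite (cardsD1 v (undominated S G)) vu eqSS.
rewrite card_pairs mulnC -sum_nat_const; apply: eq_bigr => G.
by rewrite in_set => /andP[_ /eqP].
Qed.

(** Root each graph at one of its dominated vertices outside [S], then sort by the number j of
    neighbours of the root in [S]. *)
Lemma leq_card_undominated (T : finType) d (S : {set T}) t :
  ((#|T| - #|S| - t) * #|undominated_graphs d S t| <=
    \sum_(j < d.+1) #|rooted d S t j|)%N.
Proof.
pose Q G := ~: S :\: undominated S G.
pose X := [set p : sgraph T * T | (p.1 \in undominated_graphs d S t) &&
    (p.2 \in Q p.1)].
apply: (@leq_trans #|X|).
  rewrite card_pairs mulnC -sum_nat_const; apply: leq_sum => G.
  rewrite in_set => /andP[_ /eqP tE]; rewrite cardsD (setIidPr _) ?tE.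
    by rewrite [#|~: S|]cardsCs setCK.
  by apply/subsetP => x; rewrite in_set => /andP[].
apply: leq_trans (leq_card_bigcup _ _); apply/subset_leq_card/subsetP => -[G v].
rewrite [_ \in X]in_set /= in_set in_setD in_setC => /andP[/andP[reg tE]].
move=> /andP[vu vS].
have le : (#|nbhd G v :&: S| < d.+1)%N.
  by rewrite ltnS -(eqP (forallP reg v)) subset_leq_card ?subsetIl.
apply/bigcupP; exists (Ordinal le) => //.
rewrite in_set /= reg vS eqxx /=; apply: etrans tE; congr (_ == _).
by rewrite [RHS](cardsD1 v) (negbTE vu).
Qed.

(** Summed over j, the bounds of [leq_card_rooted] form the binomial expansion of (1 + |S|/M)^d. *)
Lemma undominated_step (F : realFieldType) (T : finType) d (S : {set T}) t M :
  (0 < d)%N -> (0 < M)%N -> (M <= #|T| - 2 * #|S| - t - 2 * d - 1)%N ->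
  (#|T| - #|S| - t)%:R * #|undominated_graphs d S t|%:R <=
    (t.+1)%:R * (1 + #|S|%:R / M%:R) ^+ d * #|undominated_graphs d S t.+1|%:R :> F.
Proof.
move=> d0 M0 leM.
rewrite -natrM; apply: le_trans (_ : (\sum_(j < d.+1) #|rooted d S t j|)%:R <= _).
  by rewrite ler_nat leq_card_undominated.
rewrite mulrAC -natrM -card_rooted0 exprDn mulr_sumr natr_sum.
apply: ler_sum => j _; rewrite expr1n mul1r expr_div_n.
have Mj : 0 < (M ^ j)%:R :> F by rewrite ltr0n expn_gt0 M0.
rewrite -(ler_pM2r Mj) -natrM.
apply: le_trans (_ : (#|rooted d S t 0| * ('C(d, j) * #|S| ^ j))%:R <= _).
  rewrite ler_nat; apply: leq_trans (leq_card_rooted S t j d0).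
  rewrite leq_mul2l; apply/orP; right.
  by case: (nat_of_ord j) => // j'; rewrite leq_exp2r.
rewrite le_eqVlt; apply/orP; left; apply/eqP.
move: Mj; rewrite !natrM !natrX -[_ *+ _]mulr_natr => Mj; set y := _ ^+ j in Mj *.
field; exact: lt0r_neq0.
Qed.

(** For t < N the hypotheses make each step at least double the count; N steps give 2^N. *)
Lemma undominated_decay (F : realFieldType) (T : finType) d (S : {set T})
    s N M :
  (0 < d)%N -> (0 < M)%N -> (#|S| <= s)%N ->
  (M <= #|T| - 2 * s - N - 2 * d - 1)%N ->
  2 * N%:R * (1 + s%:R / M%:R) ^+ d <= (#|T| - s - N)%:R :> F ->
  (2 ^ N * #|undominated_graphs d S 0| <= #|[set G : sgraph T | regular d G]|)%N.
Proof.
move=> d0 M0 Ss leM hN.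
have step t : (t < N)%N ->
    (2 * #|undominated_graphs d S t| <= #|undominated_graphs d S t.+1|)%N.
  move=> tN.
  have := @undominated_step F T d S t M d0 M0.
  have -> : (M <= #|T| - 2 * #|S| - t - 2 * d - 1)%N by lia.
  move=> /(_ isT).
  set a := #|undominated_graphs d S t|; set b := #|undominated_graphs d S t.+1|; set X := (1 + _) ^+ d => st.
  have X0 : 0 <= X by rewrite exprn_ge0 // addr_ge0 // divr_ge0.
  have XY : X <= (1 + s%:R / M%:R) ^+ d.
    by rewrite lerXn2r ?nnegrE ?addr_ge0 ?divr_ge0 // lerD2l ler_wpM2r ?invr_ge0 ?ler_nat.
  have hn : t.+1%:R * (2 * X) <= (#|T| - #|S| - t)%:R.
    apply: (@le_trans _ _ (#|T| - s - N)%:R); last by rewrite ler_nat; lia.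
    apply: le_trans hN; rewrite mulrCA -[leRHS]mulrA ler_wpM2l //.
    by rewrite ler_pM // ler_nat.
  have [e|] := eqVneq (#|T| - #|S| - t)%N 0%N; first by exfalso; lia.
  rewrite -lt0n -(ltr_nat F) => p0.
  rewrite -(ler_nat F) natrM -(ler_pM2l p0) mulrCA.
  apply: le_trans (_ : 2 * (t.+1%:R * X * b%:R) <= _); first by rewrite ler_wpM2l.
  rewrite (_ : _ * _ = t.+1%:R * (2 * X) * b%:R); last by ring.
  by rewrite ler_wpM2r.
have : (2 ^ N * #|undominated_graphs d S 0| <= #|undominated_graphs d S N|)%N.
  have: (N <= N)%N by []; move: {-2}N => n; elim: n => [|n IH] nN.
    by rewrite expn0 mul1n.
  apply: leq_trans (step n nN); rewrite expnS -mulnA leq_mul2l IH //; exact: ltnW.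
move=> /leq_trans; apply; apply/subset_leq_card/subsetP => G.
by rewrite !in_set => /andP[].
Qed.

(** * Union bound over small dominating sets *)

(** Expand (1 + y)^|T| as the sum of y^|S| over all sets; a set of size at most s contributes at
    least y^s. *)
Lemma card_small_sets (F : realFieldType) (T : finType) (y : F) s :
  0 < y <= 1 ->
  #|[set S : {set T} | (#|S| <= s)%N]|%:R * y ^+ s <= (1 + y) ^+ #|T|.
Proof.
move=> /andP[y0 y1]; have -> : (1 + y) ^+ #|T| = \prod_(c : T) (y + 1).
  by rewrite prodr_const addrC.
rewrite bigA_distr /= -sum1_card natr_sum mulr_suml big_mkcond /=.
apply: ler_sum => S _; rewrite -big_mkcond /= prodr_const in_set.
case: ifP => [le|_]; last by rewrite exprn_ge0 // ltW.
by rewrite mul1r ler_wiXn2l // ltW.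
Qed.

(** By averaging, some colour class of an optimal coupon coloring is small enough, and every vertex
    has a neighbour in it. *)
Lemma small_dominating_class (T : finType) (G : sgraph T) d :
  (0 < #|T|)%N -> (0 < d)%N -> regular d G ->
  exists2 S : {set T}, (couponnum G * #|S| <= #|T|)%N & undominated S G = set0.
Proof.
move=> T0 d0 /forallP reg.
have [|k0 /existsP[c /forallP hc] _] := couponnumP (G := G) T0.
  by move=> v; rewrite -card_gt0 (eqP (reg v)).
set k := couponnum G in k0 c hc *.
pose S i := [set v | c v == i].
have sE : (\sum_i #|S i| = #|T|)%N.
  under eq_bigr => i _ do rewrite -sum1_card big_mkcond.
  rewrite exchange_big /= -sum1_card; apply: eq_bigr => v _.
  rewrite -big_mkcond (big_pred1 (c v)) // => i /=.
  by rewrite in_set eq_sym.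
have [i ik|/= hk] := pickP [pred i | (k * #|S i| <= #|T|)%N].
  exists (S i) => //; apply/setP => v; rewrite !in_set.
  have /existsP[u /andP[uv cu]] := forallP (hc v) i.
  apply/negbTE; rewrite negb_and; apply/orP; right; apply/pred0Pn; exists u.
  by rewrite /= uv in_set.
exfalso; have : (\sum_(i < k) (k * #|S i|) > \sum_(i < k) #|T|)%N.
  have lt i : (#|T| < k * #|S i|)%N by rewrite ltnNge; apply: negbT (hk i).
  rewrite [X in (X < _)%N](bigD1 (Ordinal k0)) // [X in (_ < X)%N](bigD1 (Ordinal k0)) //=.
  by rewrite -addSn leq_add // leq_sum // => i _; apply: ltnW.
by rewrite -big_distrr /= sE sum_nat_const card_ord ltnn.
Qed.

Lemma few_small_dominated (F : realFieldType) (T : finType) d s N M (y : F) :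
  (0 < d)%N -> (0 < M)%N -> 0 < y <= 1 ->
  (M <= #|T| - 2 * s - N - 2 * d - 1)%N ->
  2 * N%:R * (1 + s%:R / M%:R) ^+ d <= (#|T| - s - N)%:R :> F ->
  2 ^+ N * y ^+ s * #|[set G : sgraph T | regular d G &&
     [exists S : {set T}, (#|S| <= s)%N && (undominated S G == set0)]]|%:R
  <= (1 + y) ^+ #|T| * #|[set G : sgraph T | regular d G]|%:R.
Proof.
move=> d0 M0 y01 leM hN; set A := [set G | regular d G].
pose P := [set S : {set T} | (#|S| <= s)%N].
have sub : [set G : sgraph T | regular d G && [exists S : {set T},
    (#|S| <= s)%N && (undominated S G == set0)]] \subset
    \bigcup_(S in P) undominated_graphs d S 0.
  apply/subsetP => G; rewrite in_set => /andP[reg /existsP[S /andP[Ss S0]]].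
  by apply/bigcupP; exists S; rewrite in_set // reg cards_eq0.
have := leq_trans (subset_leq_card sub) (leq_card_bigcup _ _).
set B := #|_| => leB.
have : (2 ^ N * B <= #|P| * #|A|)%N.
  apply: (@leq_trans (2 ^ N * \sum_(S in P) #|undominated_graphs d S 0|)).
    by rewrite leq_mul2l leB orbT.
  rewrite big_distrr /= -sum_nat_const; apply: leq_sum => S.
  by rewrite in_set => Ss; apply: undominated_decay hN.
rewrite -(ler_nat F) !natrM natrX => h.
have y0 : 0 <= y ^+ s by case/andP: y01 => /ltW y0 _; rewrite exprn_ge0.
rewrite mulrAC; apply: le_trans (ler_wpM2r y0 h) _.
by rewrite mulrAC ler_wpM2r // card_small_sets.
Qed.

(** * Existence of regular graphs *)

Lemma card_ord_interval (N a b : nat) : (a <= b <= N)%N ->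
  #|[set i : 'I_N | (a <= i < b)%N]| = (b - a)%N.
Proof.
move=> /andP[ab bN].
have cE c : (c <= N)%N -> #|[set i : 'I_N | (i < c)%N]| = c.
  by move=> cN; rewrite -sum1dep_card -(big_ord_widen N (fun=> 1%N)) // sum1_card card_ord.
rewrite -[in RHS](cE a (leq_trans ab bN)) -[in RHS](cE b bN) -(cardsDS _).
  by apply: eq_card => i; rewrite !inE -leqNgt.
by apply/subsetP => i; rewrite !inE => /leq_trans; apply.
Qed.

(** The Cayley graph of the integers modulo n + 1 with connection set [D]. *)
Lemma circulant_regular (n d : nat) (D : {set 'I_n.+1}) :
  (forall x, (- x \in D) = (x \in D)) -> 0 \notin D -> #|D| = d ->
  exists G : sgraph 'I_n.+1, regular d G.
Proof.
move=> DN D0 cD; pose e (x y : 'I_n.+1) := y - x \in D.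
have es : symmetric e by move=> x y; rewrite /e -DN opprB.
have ei : irreflexive e by move=> x; rewrite /e subrr (negbTE D0).
exists (graph_of e); apply/forallP => x; apply/eqP; rewrite -cD.
rewrite -(card_imset D (@addIr _ x)); apply: eq_card => y.
rewrite nbhd_graph_of //; apply/idP/imsetP => [h|[z zD ->]].
  by exists (y - x); rewrite // subrK.
by rewrite /e addrK.
Qed.

(* A circulant graph whose connection set is an interval centred at n/2, without
   its midpoint when n - d is even. *)
Lemma regular_graph_exists (n d : nat) : (d < n)%N -> ~~ odd (n * d) ->
  exists G : sgraph 'I_n, regular d G.
Proof.
case: n => // n dn; rewrite oddM negb_and => odd_nd.
(* The interval from a to n + 1 - a is symmetric under negation modulo n + 1. It has d elements if n
   + 1 - d is odd, and d + 1 otherwise. *)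
pose a := (n.+2 - d)./2.
pose I := [set i : 'I_n.+1 | (a <= i < n.+2 - a)%N].
have a0 : (0 < a)%N by rewrite /a; lia.
have cI : #|I| = (n.+2 - a - a)%N by apply: card_ord_interval; lia.
have oN (x : 'I_n.+1) : x != 0 -> val (- x) = (n.+1 - x)%N.
  move=> x0; rewrite /= modn_small //; have := ltn_ord x.
  by have : (0 < x)%N; [rewrite lt0n | lia].
have IN x : (- x \in I) = (x \in I).
  have [->|x0] := eqVneq x 0; first by rewrite oppr0.
  by rewrite !in_set oN //; have := ltn_ord x; lia.
have I0 : 0 \notin I by rewrite in_set /=; lia.
have [odd_d|even_d] := boolP (odd (n.+1 - d)).
  by apply: (circulant_regular IN I0); rewrite cI /a; lia.
(* Now n + 1 and d have equal parity and even product, so both are even, and the midpoint (n + 1)/2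
   is its own negative. *)
have lt : (n.+1./2 < n.+1)%N by lia.
pose mid : 'I_n.+1 := Ordinal lt.
have midN : - mid = mid.
  apply: val_inj; rewrite oN /=; last by rewrite -val_eqE /=; lia.
  by lia.
apply: (@circulant_regular n d (I :\ mid)).
- by move=> x; rewrite !in_setD1 IN -{1}midN (inj_eq oppr_inj).
- by rewrite in_setD1 (negbTE I0) andbF.
have midI : mid \in I by rewrite in_set /= /a; lia.
by have := cardsD1 mid I; rewrite cI midI /a /=; move: #|_| => c; lia.
Qed.

(** * Asymptotics *)

(* Imported only here: classical_sets shadows the finset lemmas used above. *)
From mathcomp Require Import all_classical all_reals all_analysis.
Import numFieldNormedType.Exports.

(** Cubing exp(gL/3) >= gL/3 gives exp(gL) >= g^3 L^3 / 27, which explains the threshold 27C/g^3. *)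
Lemma expR_dominates_sqr (R : realType) (g C : R) : 0 < g ->
  exists2 X : R, 1 <= X & forall L, X <= L -> C * L ^+ 2 <= expR (g * L).
Proof.
move=> g0; have g3 : 0 < g ^+ 3 by rewrite exprn_gt0.
exists (Num.max 1 (27 * C / g ^+ 3)); first by rewrite le_max lexx.
move=> L; rewrite ge_max => /andP[L1 hL].
have L0 : 0 <= L by apply: le_trans L1.
have h3 : (g * L / 3) ^+ 3 <= expR (g * L).
  have {2}-> : g * L = (g * L / 3) * 3%:R by field.
  rewrite expRM_natr lerXn2r ?nnegrE ?expR_ge0 //.
    by rewrite divr_ge0 // mulr_ge0 // ltW.
  by apply: le_trans (expR_ge1Dx _); rewrite lerDr.
apply: le_trans h3; rewrite !exprMn.
move: hL; rewrite ler_pdivrMr // => hL.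
have := ler_wpM2r (exprn_ge0 2 L0) hL.
rewrite exprVn [L ^+ 3]exprS; move: (L ^+ 2) (g ^+ 3) => a b; lra.
Qed.

Lemma ln_nat_ge (R : realType) (X : R) :
  exists d0 : nat, forall d, (d0 <= d)%N -> X <= ln (d%:R : R).
Proof.
exists (Num.truncn (expR X)).+1 => d hd.
have le : expR X <= d%:R.
  by apply: ltW; apply: lt_le_trans (truncnS_gt _) _; rewrite ler_nat.
rewrite -[leLHS]expRK ler_ln ?posrE ?expR_gt0 //.
exact: lt_le_trans (expR_gt0 X) le.
Qed.

Lemma expR_half_le2 (R : realType) : expR (2^-1 : R) <= 2.
Proof.
have := expR_ge1Dx (- (2^-1) : R); rewrite expRN => h.
rewrite -[leRHS]invrK -[leLHS]invrK lef_pV2 ?posrE ?invr_gt0 ?expR_gt0 //.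
by apply: le_trans h; lra.
Qed.

(** * Exponential decay for random regular graphs *)

Definition many_coupons (R : realType) (T : finType) (d : nat) (x : R) :
    {set sgraph T} :=
  [set G : sgraph T | regular d G && (x < (couponnum G)%:R)]%SET.

Lemma many_coupons_sub (R : realType) (T : finType) (d s : nat) (x : R) :
  (0 < #|T|)%N -> (0 < d)%N -> 0 < x -> #|T|%:R / x < s.+1%:R ->
  many_coupons T d x \subset [set G : sgraph T | regular d G &&
     [exists S : {set T}, (#|S| <= s)%N && (undominated S G == finset.set0)]]%SET.
Proof.
move=> T0 d0 x0 hs; apply/fintype.subsetP => G.
rewrite !finset.in_set => /andP[reg xk]; rewrite reg /=.
have [S cS SE] := small_dominating_class T0 d0 reg.
apply/existsP; exists S; rewrite SE eqxx andbT -ltnS -(ltr_nat R).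
apply: le_lt_trans hs; rewrite ler_pdivlMr //.
move: cS; rewrite -(ler_nat R) natrM; apply: le_trans.
by rewrite mulrC ler_wpM2r // ltW.
Qed.
(** Apply [few_small_dominated] with y = 1/d. Here [eta] is the fraction of vertices that may be
    lost in M, and [beta] satisfies d alpha/(1 - eta) = beta L for alpha = L/((1 + eps) d), so that
    (1 + s/M)^d <= d^beta. *)
Lemma many_coupons_decay (R : realType) (eps : R) (n d : nat) :
  let L := ln (d%:R : R) in
  let beta := (1 + eps / 2)^-1 in
  let eta := eps / (2 * (1 + eps)) in
  0 < eps -> (0 < d)%N -> 1 <= L ->
  expR (- beta * L) <= eta ->
  8 * (L ^+ 2 + 2) <= expR ((1 - beta) * L) ->
  (2 * d + 1)%:R <= eta / 2 * n%:R ->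
  (#|many_coupons 'I_n d ((1 + eps) * (d%:R / L))|%:R : R) <=
    expR (2^-1 - n%:R / d%:R) *
      #|[set G : sgraph 'I_n | regular d G]%SET|%:R.
Proof.
move=> L beta eta eps0 d0 L1 c1 c2 hn.
pose D : R := d%:R; have D0 : 0 < D by rewrite ltr0n.
have LE : expR L = D by rewrite lnK.
(* The set has at most alpha n vertices and N is about tau n. The 4 makes 2 N d^beta <= n/2, which
   is at most n - s - N. *)
pose alpha := L / ((1 + eps) * D); pose tau := expR (- beta * L) / 4.
have L0 : 0 < L by apply: lt_le_trans L1.
have eps1 : 0 < 1 + eps by lra.
have eta0 : 0 < eta by rewrite divr_gt0 // mulr_gt0.
have eta1 : eta < 2^-1.
  by rewrite /eta ltr_pdivrMr ?mulr_gt0 // mulrA mulVf // mul1r; lra.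
have alpha0 : 0 < alpha by rewrite divr_gt0 // mulr_gt0.
have tau0 : 0 < tau by rewrite divr_gt0 ?expR_gt0.
have aL : alpha <= L / D.
  rewrite ler_pM2l // lef_pV2 ?posrE ?mulr_gt0 // ler_peMl // ?ltW //; lra.
have c2' : L ^+ 2 / D + 2 / D <= tau / 2.
  rewrite -mulrDl ler_pdivrMr // /tau -LE.
  rewrite (_ : _ * expR L = expR ((1 - beta) * L) / 8); first lra.
  rewrite (_ : (1 - beta) * L = - beta * L + L); last by ring.
  by rewrite expRD; field.
have iD0 : 0 < D^-1 by rewrite invr_gt0.
have LL : L <= L ^+ 2 by rewrite expr2 ler_peMl // ltW.
have LD : L / D <= L ^+ 2 / D by rewrite ler_pM2r.
(* Half of the margin [eta] pays for 2s + N, the other half for 2d + 1. *)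
have c3 : 2 * alpha + tau <= eta / 2.
  have := c1; rewrite /tau in c2' *; lra.
(* Per vertex, the union bound costs alpha L + 1/d; the gain tau/2 leaves another 1/d as decay
   rate. *)
have c4 : alpha * L + 2 / D <= tau / 2.
  apply: le_trans c2'; rewrite lerD2r expr2.
  rewrite (_ : L * L / D = L / D * L); last by ring.
  by rewrite ler_pM2r.
have n0 : (0 < n)%N.
  case: n hn => //; rewrite mulr0 => hn.
  by have := lt_le_trans (ltr0Sn R (2 * d)) ; rewrite -addn1 => /(_ _ hn); rewrite ltxx.
have nR : 0 < n%:R :> R by rewrite ltr0n.
pose s := Num.truncn (alpha * n%:R); pose N := Num.truncn (tau * n%:R).
have /andP[s1 s2] : s%:R <= alpha * n%:R < s.+1%:R.
  by apply: truncn_itv; rewrite mulr_ge0 // ltW.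
have /andP[N1 N2] : N%:R <= tau * n%:R < N.+1%:R.
  by apply: truncn_itv; rewrite mulr_ge0 // ltW.
pose M := (n - 2 * s - N - 2 * d - 1)%N.
have c3n : 2 * (alpha * n%:R) + tau * n%:R <= eta / 2 * n%:R.
  by rewrite mulrA -mulrDl ler_pM2r.
have e2 : eta * n%:R < n%:R / 2 by rewrite mulrC ltr_pM2l.
have MR : (1 - eta) * n%:R <= M%:R.
  have -> : (M = n - (2 * s + (N + (2 * d + 1))))%N by rewrite /M -!subnDA.
  have le : (2 * s + (N + (2 * d + 1)))%:R <= eta * n%:R.
    rewrite natrD natrD natrM; move: hn c3n s1 N1; clear; lra.
  rewrite natrB; first by move: le; clear; lra.
  rewrite -(ler_nat R); move: le e2 nR; clear; lra.
have M0 : 0 < M%:R :> R.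
  by apply: lt_le_trans MR; rewrite mulr_gt0 //; lra.
have snN : n%:R / 2 <= (n - s - N)%:R :> R.
  have le : (s + N)%:R <= n%:R / 2 :> R.
    have := mulr_ge0 (ltW alpha0) (ltW nR).
    rewrite natrD; move: c3n s1 N1 e2 nR; clear; lra.
  rewrite -subnDA natrB; first by move: le; clear; lra.
  by rewrite -(ler_nat R); move: le nR; clear; lra.
have sM : s%:R / M%:R <= alpha / (1 - eta).
  rewrite ler_pdivrMr // mulrAC ler_pdivlMr.
    apply: le_trans (ler_wpM2l (ltW alpha0) MR).
    by rewrite [_ * n%:R]mulrC mulrA ler_wpM2r // subr_ge0; move: eta1; clear; lra.
  by move: eta1; clear; lra.
have pow : (1 + s%:R / M%:R) ^+ d <= expR (beta * L).
  apply: (@le_trans _ _ (expR (s%:R / M%:R) ^+ d)).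
    apply: lerXn2r; rewrite ?nnegrE ?expR_ge0 //; last exact: expR_ge1Dx.
  rewrite -expRM_natl ler_expR.
  apply: (@le_trans _ _ (D * (alpha / (1 - eta)))); first by rewrite ler_pM2l.
  rewrite le_eqVlt; apply/orP; left; apply/eqP; rewrite /alpha /beta /eta.
  by field; lra.
have hN : 2 * N%:R * (1 + s%:R / M%:R) ^+ d <= (#|'I_n| - s - N)%:R :> R.
  rewrite card_ord; apply: le_trans snN.
  apply: (@le_trans _ _ (2 * (tau * n%:R) * expR (beta * L))).
    apply: ler_pM; [by rewrite mulr_ge0| |by rewrite ler_pM2l|exact: pow].
    by rewrite exprn_ge0 // addr_ge0 // divr_ge0.
  rewrite /tau mulNr expRN; set E := expR _.
  have E0 : E != 0 by rewrite gt_eqF // expR_gt0.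
  rewrite (_ : _ * E = n%:R / 2) //; by field.
have y01 : 0 < D^-1 <= 1.
  by rewrite iD0 invf_le1 // ler1n.
have leM : (M <= #|'I_n| - 2 * s - N - 2 * d - 1)%N by rewrite card_ord.
have M0' : (0 < M)%N by rewrite -(ltr_nat R).
have := few_small_dominated d0 M0' y01 leM hN.
set B := #|_|; set A := #|[set G | _]%SET| => few.
have leB : #|many_coupons 'I_n d ((1 + eps) * (d%:R / L))|%:R <= B%:R :> R.
  rewrite ler_nat; apply: subset_leq_card; apply: many_coupons_sub => //.
  - by rewrite card_ord.
  - by rewrite mulr_gt0 // divr_gt0.
  - rewrite card_ord (_ : _ / _ = alpha * n%:R) // /alpha.
    by field; rewrite !gt_eqF.
apply: le_trans leB _.
(* Rounding down to N > tau n - 1 produces the constant 1/2 in the final exponent. *)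
have p2 : expR (tau * n%:R / 2 - 2^-1) <= 2 ^+ N.
  apply: (@le_trans _ _ (expR (2^-1) ^+ N)); last first.
    by rewrite lerXn2r ?nnegrE ?expR_ge0 ?expR_half_le2.
  rewrite -expRM_natl ler_expR; move: N2; rewrite -natr1; clear; lra.
have ps : expR (- (alpha * n%:R * L)) <= D^-1 ^+ s.
  rewrite -LE -expRN -expRM_natl ler_expR mulrN lerN2.
  by rewrite ler_pM2r.
have pn : (1 + D^-1) ^+ n <= expR (n%:R / D).
  rewrite expRM_natl; apply: lerXn2r; rewrite ?nnegrE ?expR_ge0 //.
    by rewrite addr_ge0 // ltW.
  exact: expR_ge1Dx.
rewrite card_ord in few.
have : expR (tau * n%:R / 2 - 2^-1) * expR (- (alpha * n%:R * L)) * B%:R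
    <= expR (n%:R / D) * A%:R.
  apply: le_trans (le_trans _ few) _; last by rewrite ler_wpM2r.
  by rewrite ler_wpM2r // ler_pM ?expR_ge0.
rewrite -expRD; set E := expR (_ + _).
have E0 : 0 < E by rewrite expR_gt0.
rewrite -ler_pdivlMl // => /le_trans; apply.
rewrite mulrA ler_wpM2r // /E -expRN -expRD ler_expR.
have := ler_wpM2r (ltW nR) c4; rewrite -/D; clear.
rewrite mulrDl; lra.
Qed.

(** * Lower bound for all regular graphs *)

Lemma expr_one_sub_inv_le (R : realType) (K n : nat) : (0 < K)%N ->
  (1 - K%:R^-1) ^+ n <= expR (- (n%:R / K%:R)) :> R.
Proof.
move=> K0; rewrite -mulrN expRM_natl lerXn2r ?nnegrE ?expR_ge0 //.
  by rewrite subr_ge0 invf_le1 ?ler1n ?ltr0n.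
exact: expR_ge1Dx.
Qed.

(** With q = d^(1 - delta/2), the first stage has (1 + p)^(k + r) <= e^q and 2^m >= e^(2q), so
    e^(-q) must beat 4 d^4; q >= 6L and 4 <= d^2 suffice. In the second, r >= (5L + 1) m yields
    d^(-5) against 4 k d^2 <= d^5. *)
Lemma regular_coupon_colorable (R : realType) (delta : R) (d k r m : nat)
    (T : finType) (G : sgraph T) :
  let L := ln (d%:R : R) in let P := d%:R / L in
  let q := expR ((1 - delta / 2) * L) in
  0 < delta -> delta < 1 -> 1 <= L ->
  6 * L ^+ 2 <= expR (2^-1 * L) ->
  (k + r)%:R <= (1 - delta / 2) * P ->
  4 * q <= m%:R -> (5 * L + 1) * m%:R <= r%:R ->
  (0 < k)%N -> (0 < d)%N -> regular d G -> coupon_colorable G k.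
Proof.
move=> L P q de0 de1 L1 hL hK hm hr k0 d0 reg.
have D0 : 0 < d%:R :> R by rewrite ltr0n.
have LE : expR L = d%:R by rewrite lnK.
have L0 : 0 < L by apply: lt_le_trans L1.
have P0 : 0 < P by rewrite divr_gt0.
have q0 : 0 < q by rewrite expR_gt0.
have m0 : (0 < m)%N.
  by rewrite -(ltr_nat R); apply: lt_le_trans hm; rewrite mulr_gt0.
have mR : 0 < m%:R :> R by rewrite ltr0n.
have K0 : (0 < k + r)%N by rewrite addn_gt0 k0.
have KR : 0 < (k + r)%:R :> R by rewrite ltr0n.
have c0 : 0 < 1 - delta / 2 by move: de1; clear; lra.
have c1 : 1 - delta / 2 < 1 by move: de0; clear; lra.
have KP : (k + r)%:R <= P.
  by apply: le_trans hK _; rewrite ler_piMl // ltW.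
have PD : P <= d%:R by rewrite ler_pdivrMr // ler_peMr // ltW.
have q6 : 6 * L <= q.
  apply: le_trans (le_trans _ hL) _.
    by rewrite ler_pM2l // expr2 ler_peMl // ltW.
  by rewrite ler_expR ler_pM2r //; move: de1; clear; lra.
have e4 : 4 <= expR (2 * L).
  rewrite expRM_natl (_ : 4 = 2 ^+ 2); last by ring.
  rewrite lerXn2r ?nnegrE ?expR_ge0 //.
  by apply: le_trans (expR_ge1Dx _); move: L1; clear; lra.
apply: (@two_stage_coloring R T G d k r m) => //.
- set p := d%:R * _.
  have p0 : 0 <= p.
    by rewrite mulr_ge0 // exprn_ge0 // subr_ge0 invf_le1 // ler1n.
  have hp : p <= expR (- (delta / 2 * L)).
    apply: le_trans (ler_wpM2l (ltW D0) (expr_one_sub_inv_le R d K0)) _.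
    rewrite -{1}LE -expRD ler_expR.
    (* This holds because (1 + delta/2)(1 - delta/2) <= 1. *)
    suff : (1 + delta / 2) * L <= d%:R / (k + r)%:R by clear; lra.
    rewrite ler_pdivlMr //.
    apply: (@le_trans _ _ ((1 + delta / 2) * L * ((1 - delta / 2) * P))).
      by rewrite ler_wpM2l // mulr_ge0 ?(ltW L0) //; move: de0; clear; lra.
    have -> : (1 + delta / 2) * L * ((1 - delta / 2) * P) =
        (1 - (delta / 2) ^+ 2) * d%:R by rewrite /P; field; rewrite gt_eqF.
    by rewrite ler_piMl ?(ltW D0) // gerBl exprn_ge0 // divr_ge0 // ltW.
  have h1 : (1 + p) ^+ (k + r) <= expR q.
    apply: (@le_trans _ _ (expR p ^+ (k + r))).
      rewrite lerXn2r ?nnegrE ?expR_ge0 ?expR_ge1Dx //.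
      by rewrite addr_ge0.
    rewrite -expRM_natl ler_expR.
    apply: (@le_trans _ _ (d%:R * expR (- (delta / 2 * L)))).
      by apply: ler_pM => //; apply: le_trans PD.
    rewrite -LE -expRD ler_expR le_eqVlt; apply/orP; left; apply/eqP.
    by ring.
  have h2 : expR (2 * q) <= 2 ^+ m.
    apply: (@le_trans _ _ (expR (2^-1) ^+ m)).
      by rewrite -expRM_natl ler_expR; move: hm; clear; lra.
    by rewrite lerXn2r ?nnegrE ?expR_ge0 ?expR_half_le2.
  have h3 : (1 + p) ^+ (k + r) / 2 ^+ m <= expR (- q).
    rewrite ler_pdivrMr ?exprn_gt0 //; apply: le_trans h1 _.
    apply: le_trans (ler_wpM2l (expR_ge0 _) h2).
    by rewrite -expRD ler_expR; clear; lra.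
  rewrite natrX -LE -expRM_natl.
  apply: (@le_trans _ _ (expR (2 * L) * expR (- q) * expR (4 * L))).
    rewrite ler_wpM2r ?expR_ge0 //; apply: ler_pM => //.
    by rewrite divr_ge0 ?exprn_ge0 // addr_ge0.
  rewrite -!expRD -[leRHS]expR0 ler_expR; move: q6; clear; lra.
have mr : (m <= r)%N.
  rewrite -(ler_nat R); apply: le_trans hr; rewrite ler_peMl ?ltW //.
  by move: L0; clear; lra.
have kD : k%:R <= expR L.
  rewrite LE; apply: le_trans PD; apply: le_trans KP.
  by rewrite ler_nat leq_addr.
have h : (1 - m%:R^-1) ^+ (r - m) <= expR (- (5 * L)).
  apply: le_trans (expr_one_sub_inv_le R _ m0) _.
  rewrite ler_expR lerN2 natrB // ler_pdivlMr //; move: hr; clear; lra.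
rewrite natrX -LE -expRM_natl.
apply: (@le_trans _ _ (expR (2 * L) * (expR L * expR (- (5 * L))) * expR (2 * L))).
  rewrite ler_wpM2r ?expR_ge0 //.
  have h0 : 0 <= (1 - m%:R^-1) ^+ (r - m) :> R.
    by rewrite exprn_ge0 // subr_ge0 invf_le1 ?ler1n.
  by apply: ler_pM => //; [rewrite mulr_ge0|apply: ler_pM].
by rewrite -!expRD -[leRHS]expR0 ler_expR; clear; lra.
Qed.

Lemma regular_lower (R : realType) (delta : R) : 0 < delta ->
  exists d0 : nat, forall d : nat, (d0 <= d)%N ->
    forall (T : finType) (G : sgraph T), (0 < #|T|)%N -> regular d G ->
      (1 - delta) * (d%:R / ln d%:R) <= (couponnum G)%:R.
Proof.
move=> de0; have [de1|de1] := leP 1 delta.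
  exists 1%N => d d1 T G _ _; apply: (@le_trans _ _ 0) => //.
  by rewrite mulr_le0_ge0 ?subr_le0 // divr_ge0 // ln_ge0 // ler1n.
have half0 : 0 < 2^-1 :> R by rewrite invr_gt0.
have de2 : 0 < delta / 2 by rewrite divr_gt0.
have [X1 X11 hX1] := expR_dominates_sqr 6 half0.
have [X2 X21 hX2] := expR_dominates_sqr (240 / delta) de2.
have [d0 hd0] := ln_nat_ge (Num.max X1 X2).
exists d0.+1 => d hd T G T0 reg.
have dp : (0 < d)%N by apply: leq_trans hd.
have := hd0 d (ltnW hd); set L := ln (d%:R : R); rewrite ge_max => /andP[L1 L2].
have L1' : 1 <= L by apply: le_trans L1.
have L0 : 0 < L by apply: lt_le_trans L1'.
have LE : expR L = d%:R by rewrite lnK // posrE ltr0n.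
set P := d%:R / L.
have P0 : 0 < P by rewrite divr_gt0 // ltr0n.
pose q := expR ((1 - delta / 2) * L).
have qL : 240 * L * q <= delta * P.
  rewrite -ler_pdivrMl // /P -LE ler_pdivlMr //.
  rewrite (_ : L = delta / 2 * L + (1 - delta / 2) * L) ?expRD; last by ring.
  rewrite -/q; apply: le_trans (ler_wpM2r (expR_ge0 _) (hX2 _ L2)).
  by rewrite le_eqVlt; apply/orP; left; apply/eqP; rewrite -/q; field; rewrite gt_eqF.
have q1 : 1 <= q.
  rewrite -[leLHS]expR0 ler_expR mulr_ge0 ?(ltW L0) //; move: de1; clear; lra.
have Lq : L <= L * q by rewrite ler_peMr // ltW.
(* Rounding is absorbed by delta P >= 4, giving k + r <= (1 - delta/2) P. The 240 in [qL] ensures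
   (5L + 1) m <= 30 L q <= delta P/8, within reach of r, which is about delta P/4. *)
pose k := (Num.truncn ((1 - delta) * P)).+1.
pose r := Num.truncn (delta / 4 * P).
pose m := (Num.truncn (4 * q)).+1.
have k1 : (1 - delta) * P < k%:R by apply: truncnS_gt.
have k2 : k%:R <= (1 - delta) * P + 1.
  rewrite -[leLHS]natr1 lerD2r truncn_le mulr_ge0 ?(ltW P0) //.
  by rewrite subr_ge0 ltW.
have r1 : r%:R <= delta / 4 * P.
  by rewrite truncn_le mulr_ge0 ?(ltW P0) // divr_ge0 // ltW.
have r2 : delta / 4 * P < r%:R + 1 by rewrite natr1; apply: truncnS_gt.
have m1 : 4 * q < m%:R by apply: truncnS_gt.
have m2 : m%:R <= 4 * q + 1.
  by rewrite -[leLHS]natr1 lerD2r truncn_le mulr_ge0 // expR_ge0.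
have kp : (0 < k)%N by [].
clearbody k r m.
have col : coupon_colorable G k.
  apply: (@regular_coupon_colorable R delta d k r m) => //.
  - exact: hX1.
  - have y4 : 4 <= delta * P.
      apply: le_trans qL; rewrite -mulrA -[leLHS]mulr1.
      by apply: ler_pM => //; [rewrite ler_nat|exact: le_trans Lq].
    have kr : k%:R + r%:R <= (1 - delta / 2) * P.
      by move: k2 r1 y4; clear; lra.
    by rewrite natrD.
  - exact: ltW.
  rewrite -/L; apply: (@le_trans _ _ (6 * L * (5 * q))).
    apply: ler_pM => //.
    - by move: L1'; clear; lra.
    - by move: L1'; clear; lra.
    - by move: m2 q1; clear; lra.
  rewrite (_ : _ * _ = 30 * (L * q)); last by ring.
  move: r2 qL Lq L1'; rewrite -(mulrA 240); move: (L * q) => x; clear; lra.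
have nb v : nbhd G v != finset.set0.
  by rewrite -card_gt0 (eqP (forallP reg v)).
have [_ _ ub] := couponnumP T0 nb.
apply: (@le_trans _ _ k%:R); first exact: ltW.
by rewrite ler_nat ub.
Qed.

(** * Convergence of the probability *)

Local Open Scope classical_set_scope.

Lemma random_regular_upper (R : realType) (epsilon : R) : 0 < epsilon ->
  exists d1 : nat, forall d : nat, (d1 <= d)%N ->
    unif_prob R
      [set G : sgraph 'I_n | regular d G]%SET
      [set G : sgraph 'I_n |
        (couponnum G)%:R <= (1 + epsilon) * (d%:R / ln d%:R)]%SET
      @[n --> within [set n : nat | ~~ odd (n * d)] \oo] --> (1 : R).
Proof.
move=> eps0.
pose beta := (1 + epsilon / 2)^-1; pose eta := epsilon / (2 * (1 + epsilon)).
have b0 : 0 < beta by rewrite invr_gt0; lra.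
have b1 : 0 < 1 - beta by rewrite subr_gt0 invf_lt1; lra.
have eta0 : 0 < eta by rewrite divr_gt0 // mulr_gt0 //; lra.
have [X1 X11 hX1] := expR_dominates_sqr eta^-1 b0.
(* For L >= 1, 8 (L^2 + 2) <= 24 L^2. *)
have [X2 X21 hX2] := expR_dominates_sqr 24 b1.
have [d0 hd0] := ln_nat_ge (Num.max X1 X2).
exists d0.+1 => d hd.
have dp : (0 < d)%N by apply: leq_trans hd.
have := hd0 d (ltnW hd); set L := ln (d%:R : R); rewrite ge_max => /andP[L1 L2].
have L1' : 1 <= L by apply: le_trans L1.
have c1 : expR (- beta * L) <= eta.
  rewrite mulNr expRN -[leRHS]invrK lef_pV2 ?posrE ?invr_gt0 ?expR_gt0 //.
  apply: le_trans (hX1 _ L1); rewrite ler_peMr ?invr_ge0 ?(ltW eta0) //.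
  by rewrite expr_ge1 //; lra.
have c2 : 8 * (L ^+ 2 + 2) <= expR ((1 - beta) * L).
  apply: le_trans (hX2 _ L2).
  by have : 1 <= L ^+ 2 by [rewrite expr_ge1 //; lra]; lra.
have dR : 0 < d%:R :> R by rewrite ltr0n.
apply: (@squeeze_cvgr _ _ _ _ (fun n => 1 - expR (2^-1 - n%:R / d%:R)) (cst 1)).
- rewrite near_withinE; near=> n => /= odd_nd.
  have dn : (d < n)%N by near: n; exact: nbhs_infty_gt.
  have hn : (2 * d + 1)%:R <= eta / 2 * n%:R.
    have eta2 : 0 < eta / 2 by rewrite divr_gt0.
    by rewrite -(ler_pdivrMl _ _ eta2); near: n; exact: nbhs_infty_ger.
  have := many_coupons_decay eps0 dp L1' c1 c2 hn.
  rewrite /unif_prob; set A := [set G | _]%SET; set E := [set G | _]%SET.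
  have -> : many_coupons 'I_n d ((1 + epsilon) * (d%:R / L)) = A :\: E.
    by apply/setP => G; rewrite !finset.inE andbC -ltNge.
  (* Without a regular graph the probability would be 0 by convention, so existence is essential for
     the limit. *)
  have A0 : 0 < #|A|%:R :> R.
    rewrite ltr0n; apply/card_gt0P.
    by have [G reg] := regular_graph_exists dn odd_nd; exists G; rewrite finset.inE.
  have := cardsID E A => /(congr1 (fun k => k%:R : R)); rewrite natrD.
  move=> e le; rewrite ler_pdivrMr // ler_pdivlMr // -{}e mul1r.
  by rewrite lerDl ler0n andbT mulrBl mul1r lerBlDr lerD2l -natrD cardsID.
- apply: cvg_trans; first by apply: cvg_app; exact: cvg_within.
  rewrite -[X in _ --> X]subr0; apply: cvgB; first exact: cvg_cst.
  rewrite (_ : (fun n : nat => _) =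
    geometric (expR 2^-1) (expR (- d%:R^-1)) :> (nat -> R)); last first.
    apply/funext => n; rewrite /= -expRM_natl -expRD; congr expR.
    by rewrite mulrN.
  apply: cvg_geometric; rewrite ger0_norm ?expR_ge0 // expRN invf_lt1 ?expR_gt0 //.
  by rewrite expR_gt1 invr_gt0.
- exact: cvg_cst.
Unshelve. all: by end_near.
Qed.

Theorem theorem1 (R : realType) :
  (forall delta : R, 0 < delta ->
    exists d0 : nat, forall d : nat, (d0 <= d)%N ->
      forall (T : finType) (G : sgraph T), (0 < #|T|)%N -> regular d G ->
        (1 - delta) * (d%:R / ln d%:R) <= (couponnum G)%:R)
  /\
  (forall epsilon : R, 0 < epsilon ->
    exists d1 : nat, forall d : nat, (d1 <= d)%N ->
      unif_prob R
        [set G : sgraph 'I_n | regular d G]%SET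
        [set G : sgraph 'I_n |
          (couponnum G)%:R <= (1 + epsilon) * (d%:R / ln d%:R)]%SET
        @[n --> within [set n : nat | ~~ odd (n * d)] \oo] --> (1 : R)).
Proof.
by split; [exact: regular_lower|exact: random_regular_upper].
Qed.
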